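(* Let $H$ be a separable (real) Hilbert space and let $\mu_n\in\mathcal{P}_2(H)$ for every $n\in\mathbb{N}^*\cup\{\infty\}$. The following properties are equivalent: (i) $\mathcal{W}_2(\mu_n,\mu_\infty)\to0$ as $n\to+\infty$; (ii) $e_{2,2}(\mu_n,\cdot)\to e_{2,2}(\mu_\infty,\cdot)$ uniformly on $H^2$ as $n\to+\infty$; (iii) $e_{2,2}(\mu_n,\cdot)\to e_{2,2}(\mu_\infty,\cdot)$ pointwise on $H^2$ as $n\to+\infty$.
   Context: $H$ (finite- or infinite-dimensional) has inner product $(\cdot\mid\cdot)$ and induced norm $|\cdot|$. $\mathcal{P}_2(H)$ is the set of Borel probability measures $\mu$ on $H$ with $\int_H|\xi|^2\mu(d\xi)<+\infty$. $\mathcal{W}_2$ is the $L^2$-Wasserstein distance: $\mathcal{W}_2(\mu,\nu)=\big(\inf_\pi\int_{H\times H}|x-y|^2\pi(dx,dy)\big)^{1/2}$, the infimum being over all couplings $\pi$ of $\mu$ and $\nu$. For $\mu\in\mathcal{P}_2(H)$ and $(a,b)\in H^2$, $e_{2,2}(\mu,(a,b))=\big[\int_H\min(|\xi-a|^2,|\xi-b|^2)\,\mu(d\xi)\big]^{1/2}$. *)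

(* Defs.v *)
From HB Require Import structures.
From mathcomp Require Import all_boot all_order all_algebra.
From mathcomp Require Import all_classical all_reals all_analysis.

Set Implicit Arguments.
Unset Strict Implicit.
Unset Printing Implicit Defensive.

Import Order.TTheory GRing.Theory Num.Theory.
Import numFieldNormedType.Exports.

Local Open Scope classical_set_scope.
Local Open Scope ring_scope.

Definition separable_space (T : topologicalType) : Prop :=
  exists2 D : set T, countable D & dense D.

Notation borel T := (g_sigma_algebraType (@open T)).

Section Wasserstein.
Context {R : realType} {H : completeNormedModType R}.
Implicit Types mu nu : probability (borel H) R.

Definition finite_second_moment mu : Prop :=
  (\int[mu]_xi (`|xi : H| ^+ 2)%:E < +oo)%E.

(* Couplings live on the product of the two Borel sigma-algebras, which is the
   Borel sigma-algebra of H * H when H is separable.  The marginals are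
   compared on measurable sets only: the value of a [probability] on a
   non-measurable set is unspecified. *)
Definition coupling mu nu (pi : probability (borel H * borel H)%type R) : Prop :=
  forall A : set (borel H), measurable A ->
    pi (fst @^-1` A) = mu A /\ pi (snd @^-1` A) = nu A.

Definition W2 mu nu : \bar R :=
  sqrte (ereal_inf [set (\int[pi]_z (`|(z.1 : H) - z.2| ^+ 2)%:E)%E
                   | pi in coupling mu nu]).

(* [\int] in [ring_scope] is real-valued: it takes the junk value 0 when the
   integral is infinite, which cannot happen under [finite_second_moment mu].
   Real values are needed here, since the uniform structure of [\bar R] is not
   the one given by `|x - y| on [R]. *)
Definition e22 mu (ab : H * H) : R :=
  Num.sqrt (\int[mu]_xi
    Num.min (`|(xi : H) - ab.1| ^+ 2) (`|(xi : H) - ab.2| ^+ 2)).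

End Wasserstein.

(* Main.v *)
From HB Require Import structures.
Require Import Defs.
From mathcomp Require Import all_boot all_order all_algebra.
From mathcomp Require Import all_classical all_reals all_analysis.
From mathcomp Require Import measurable_realfun ring lra.
Import Order.TTheory GRing.Theory Num.Theory.
Import numFieldNormedType.Exports.
Local Open Scope classical_set_scope.
Local Open Scope ring_scope.

Set Implicit Arguments.
Unset Strict Implicit.
Unset Printing Implicit Defensive.

(* (i) => (ii): for any coupling of [mu] and [nu], Minkowski's inequality bounds
   [e22 mu - e22 nu], uniformly in [(a, b)], by the L^2 cost of the coupling.

   (iii) => (i): taking [a = b] gives convergence of the second moments, and
   [|x - a|^2 - min (|x - a|^2, |x - b|^2)] is the positive part of an affine
   function, so the integrals of all ridge functions [max 0 ((x | u) + c)]
   converge.  Piecewise linear interpolation, with an error controlled by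
   [eps (1 + |x|^2)], extends this to [cos ((x | u) + c)] and hence to the
   algebra of trigonometric polynomials they span.  It then suffices to have
   trigonometric polynomials [phi i >= 0] of sum 1 and points [s i] such that
   [W x = sum_i phi i x |x - s i|^2] has a small integral for the limit measure
   [mu]: the integrals of [W] converge, and coupling the pieces [phi i mu_n] and
   [phi j mu] independently, with weights given by a coupling of their masses
   that keeps as much as possible on the diagonal, costs at most
   [3 int W dmu_n + 3 int W dmu + o(1)].  Such a [W] exists because the
   [0,1]-valued functions that are limits of [0,1]-valued trigonometric
   polynomials in L^1 ((1 + |x|^2) dmu) are stable under products, complements
   and pointwise limits, and therefore contain the indicators of half-spaces
   and of closed balls. *)

(** * Real functions and discrete couplings *)

Section RealLemmas.
Context {R : realType}.
Implicit Types (x y t c h : R) (n m k : nat).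

Lemma cos_lipschitz x y : `|cos x - cos y| <= `|x - y|.
Proof.
wlog xy : x y / x <= y.
  move=> wl; have [/wl//|/ltW/wl] := leP x y.
  by rewrite distrC (distrC x).
rewrite distrC (distrC x).
have [c _ ->] : exists2 c, c \in `[x, y]%R & cos y - cos x = - sin c * (y - x).
  apply: MVT_segment => //.
  exact/continuous_subspaceT/continuous_cos.
by rewrite normrM normrN ler_piMl // sin_max.
Qed.

(** By the mean value theorem the difference is [(cos c - 1) * t] with [c] between 0 and [t], and
    [cos] is 1-Lipschitz. A quadratic error is what the weight [1 + |x|^2] can absorb later. *)
Lemma sin_sub_le_sqr t : `|sin t - t| <= t ^+ 2.
Proof.
wlog t0 : t / 0 <= t.
  move=> wl; have [/wl//|/ltW t0] := leP 0 t.
  have := wl (- t); rewrite sinN oppr_ge0 => /(_ t0).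
  by rewrite -opprD normrN sqrrN.
pose f x := sin x - x.
have [c cI] : exists2 c, c \in `[0, t]%R & f t - f 0 = (cos c - 1) * (t - 0).
  apply: MVT_segment => //.
  apply/continuous_subspaceT => x.
  by apply: cvgB; [exact: continuous_sin|exact: cvg_id].
rewrite /f sin0 !subr0 => ->.
move: cI; rewrite in_itv /= => /andP[c0 ct].
rewrite normrM (ger0_norm t0) expr2 ler_wpM2r //.
rewrite -cos0 (le_trans (cos_lipschitz _ _)) // subr0 ger0_norm //.
Qed.

Lemma bernoulli_ineq x n : -1 <= x -> 1 + n%:R * x <= (1 + x) ^+ n.
Proof.
move=> x1; elim: n => [|n IH]; first by rewrite mul0r addr0 expr0.
rewrite exprS.
have x1' : 0 <= 1 + x by lra.
apply: le_trans (ler_wpM2l x1' IH).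
rewrite -natr1.
have : 0 <= n%:R * (x * x) by rewrite mulr_ge0 // -expr2 sqr_ge0.
nra.
Qed.

(** With [x = r^2], Bernoulli's inequality for [1 / r] bounds [n * r^n], and the remaining factor
    [r^n] tends to 0. *)
Lemma cvg_natr_mul_expr x : 0 <= x < 1 -> n%:R * x ^+ n @[n --> \oo] --> 0.
Proof.
move=> /andP[x0 x1].
have [->|xn0] := eqVneq x 0.
  apply/cvg_ballP => e e0; near=> n.
  rewrite expr0n gtn_eqF ?mulr0 /ball /= ?subrr ?normr0 //.
  by near: n; exists 1%N.
have xgt0 : 0 < x by rewrite lt_neqAle eq_sym xn0.
pose r := Num.sqrt x.
have r0 : 0 < r by rewrite sqrtr_gt0.
have r1 : r < 1 by rewrite -sqrtr1 ltr_sqrt.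
have xr : x = r ^+ 2 by rewrite sqr_sqrtr.
pose d := r^-1 - 1.
have d0 : 0 < d by rewrite subr_gt0 invf_gt1.
have bnd n : n%:R * r ^+ n <= d^-1.
  have := @bernoulli_ineq d n; rewrite (_ : 1 + d = r^-1); last by rewrite /d; lra.
  have dm : -1 <= d by lra.
  move=> /(_ dm) H.
  rewrite -[d^-1]mul1r ler_pdivlMr // mulrAC.
  have rn0 : 0 < r ^+ n by rewrite exprn_gt0.
  rewrite -ler_pdivlMr // div1r -exprVn.
  by apply: le_trans H; rewrite lerDr.
have rc : d^-1 * r ^+ n @[n --> \oo] --> 0.
  rewrite -[X in _ --> X](mulr0 d^-1); apply: cvgMr; apply: cvg_expr.
  by rewrite ger0_norm // ltW.
apply: (squeeze_cvgr (f := fun=> 0) _ (cvg_cst _) rc).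
near=> n; apply/andP; split; first by rewrite mulr_ge0 // exprn_ge0.
rewrite xr -exprM mul2n -addnn exprD mulrA.
by rewrite ler_wpM2r // exprn_ge0 // ltW.
Unshelve. all: by end_near. Qed.

(** These polynomials turn a [0,1]-valued function into the indicator of a sublevel set. The
    exponent is chosen so that [n * 2^n * y^n = n * (2 y)^n], which is small for [y < 1/2] and at
    least [n] for [y >= 1/2]. *)
Lemma cvg_step_poly y : 0 <= y <= 1 ->
  (1 - y ^+ n) ^+ (n * 2 ^ n) @[n --> \oo] --> (if y < 2^-1 then 1 else 0 : R).
Proof.
move=> /andP[y0 y1].
have yn0 n : 0 <= y ^+ n by rewrite exprn_ge0.
have yn1 n : y ^+ n <= 1 by rewrite exprn_ile1.
have Nz n : (n * 2 ^ n)%:R * y ^+ n = n%:R * (2 * y) ^+ n.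
  by rewrite natrM natrX exprMn mulrA.
case: ifPn => [y2|].
  have q : 0 <= 2 * y < 1 by apply/andP; split; lra.
  have l1 : 1 - n%:R * (2 * y) ^+ n @[n --> \oo] --> (1 : R).
    rewrite -[X in _ --> X]subr0; apply: cvgB; first exact: cvg_cst.
    exact: cvg_natr_mul_expr.
  apply: (squeeze_cvgr (h := fun=> 1) _ l1 (cvg_cst _)).
  near=> n; apply/andP; split; last first.
    by rewrite exprn_ile1 ?subr_ge0 // gerBl.
  rewrite -Nz -mulrN; apply: bernoulli_ineq.
  by rewrite lerNl opprK.
rewrite -leNgt => y2.
apply: (squeeze_cvgr (f := fun=> 0) _ (cvg_cst _) cvg_harmonic).
near=> n; apply/andP; split; first by rewrite exprn_ge0 // subr_ge0.
rewrite /= -[_^-1]mul1r ler_pdivlMr ?ltr0n //.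
(* Since [(1 - y^n) (1 + y^n) <= 1], Bernoulli's lower bound for the second power, here at least
   [n + 1], yields an upper bound for the first. *)
have : (1 - y ^+ n) ^+ (n * 2 ^ n) * (1 + y ^+ n) ^+ (n * 2 ^ n) <= 1.
  rewrite -exprMn exprn_ile1 //.
    by rewrite mulr_ge0 ?subr_ge0 // addr_ge0.
  rewrite -subr_sqr expr1n gerBl sqr_ge0 //.
apply: le_trans; rewrite ler_wpM2l ?exprn_ge0 ?subr_ge0 //.
have H := @bernoulli_ineq (y ^+ n) (n * 2 ^ n)%N.
apply: le_trans (H _); last by apply: le_trans (yn0 n); rewrite lerN10.
rewrite Nz -natr1 addrC lerD2l ler_peMr // exprn_ege1 //; lra.
Unshelve. all: by end_near. Qed.

(** Piecewise linear interpolation at the nodes [x + k * h], constant outside the segment, built one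
    node at a time. [P] stands for any linear class containing constants and ramps. On each cell
    both [g] and the interpolant move by at most [h], whence the error [2 * h]. *)
Lemma ramp_approx_segment (P : (R -> R) -> Prop)
    (P_cst : forall c, P (fun=> c)) (P_ramp : forall c, P (fun t => Num.max 0 (t + c)))
    (PD : forall f g, P f -> P g -> P (fun t => f t + g t))
    (PZ : forall c f, P f -> P (fun t => c * f t))
    (g : R -> R) (g_lip : forall x y, `|g x - g y| <= `|x - y|) x h n : 0 < h ->
  exists2 f, P f &
    [/\ forall t, t <= x -> f t = g x,
        forall t, x + n%:R * h <= t -> f t = g (x + n%:R * h) &
        forall t, x <= t <= x + n%:R * h -> `|g t - f t| <= 2 * h].
Proof.
move=> h0; elim: n => [|n [f Pf [fl fr fm]]].
  exists (fun=> g x) => //; rewrite mul0r addr0; split => // t /andP[xt tx].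
  by rewrite (le_anti (_ : t <= x <= t)) ?tx // subrr normr0; lra.
pose z := x + n%:R * h; rewrite -/z in fr fm.
have zS : x + n.+1%:R * h = z + h by rewrite /z -natr1 mulrDl mul1r addrA.
rewrite zS.
have xz : x <= z by rewrite /z lerDl mulr_ge0 // ltW.
pose D := g (z + h) - g z.
have Dh : `|D| <= h by rewrite (le_trans (g_lip _ _)) // addrAC subrr add0r gtr0_norm.
(* [s] rises linearly from 0 at [z] to 1 at [z + h] and is constant elsewhere, so adding [D * s]
   extends the interpolation to the next node. *)
pose s t := h^-1 * (Num.max 0 (t + - z) + -1 * Num.max 0 (t + - (z + h))).
have s0 t : t <= z -> s t = 0.
  by move=> tz; rewrite /s !max_l; lra.
have s1 t : z + h <= t -> s t = 1.
  move=> tz; rewrite /s !max_r; [|lra..].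
  have -> : t - z + -1 * (t - (z + h)) = h by ring.
  by rewrite mulVf // gt_eqF.
have s01 t : z <= t <= z + h -> 0 <= s t <= 1.
  move=> tz; rewrite /s max_r; last lra.
  rewrite max_l; last lra.
  rewrite mulr0 addr0 mulrC ler_pdivrMr // mul1r; apply/andP; split; last lra.
  by rewrite mulr_ge0 ?invr_ge0 ?(ltW h0) //; lra.
exists (fun t => f t + D * s t).
  apply: (PD _ _ Pf); apply: (PZ); apply: (PZ); apply: (PD) => //.
  exact: (PZ _ _ (P_ramp _)).
split => t.
- by move=> tx; rewrite fl // s0 ?mulr0 ?addr0 // (le_trans tx).
- move=> zt; rewrite fr ?s1 //; last lra.
  by rewrite /D; lra.
- move=> /andP[xt tz]; have [tz'|zt] := leP t z.
    by rewrite s0 // mulr0 addr0; apply: fm; rewrite xt.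
  rewrite fr ?(ltW zt) // opprD addrA (le_trans (ler_normB _ _)) //.
  have : `|g t - g z| <= h by rewrite (le_trans (g_lip _ _)) // ger0_norm; lra.
  have : `|D * s t| <= h.
    have /andP[? ?] : 0 <= s t <= 1 by apply: s01; lra.
    by rewrite normrM (ger0_norm (x := s t)) // (le_trans _ Dh) // ler_piMr.
  lra.
Qed.

Lemma ramp_approx (P : (R -> R) -> Prop)
    (P_cst : forall c, P (fun=> c)) (P_ramp : forall c, P (fun t => Num.max 0 (t + c)))
    (PD : forall f g, P f -> P g -> P (fun t => f t + g t))
    (PZ : forall c f, P f -> P (fun t => c * f t))
    (g : R -> R) (g_lip : forall x y, `|g x - g y| <= `|x - y|)
    (g_le1 : forall t, `|g t| <= 1) e : 0 < e ->
  exists2 f, P f & forall t, `|g t - f t| <= e * (1 + t ^+ 2).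
Proof.
(* Beyond [L] the trivial error 2 is at most [e * L^2], hence at most [e * t^2]. Between [-L] and
   the last node, which is at least [L], the mesh [e / 2] gives the error [e]. *)
move=> e0; pose L := Num.max 1 (2 / e).
have L1 : 1 <= L by rewrite le_max lexx.
have L2 : 2 <= e * L ^+ 2.
  have : 2 / e <= L by rewrite le_max lexx orbT.
  rewrite ler_pdivrMr // => H; apply: le_trans H _.
  by rewrite mulrC ler_pM2l // expr2 ler_peMl //; lra.
have e20 : 0 < e / 2 by rewrite divr_gt0.
have [n nL] : exists n, 2 * L <= n%:R * (e / 2).
  exists (Num.truncn (2 * L / (e / 2))).+1.
  by rewrite -ler_pdivrMr // ltW // truncnS_gt.
have [f Pf [fl fr fm]] :=
  ramp_approx_segment P_cst P_ramp PD PZ g_lip (- L) n e20.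
exists f => // t.
have far z : L <= `|t| -> f t = g z -> `|g t - f t| <= e * (1 + t ^+ 2).
  move=> tL ->; apply: (@le_trans _ _ 2).
    rewrite (le_trans (ler_normB _ _)) //.
    by have := g_le1 t; have := g_le1 z; lra.
  apply: le_trans L2 _; rewrite ler_pM2l //.
  apply: (@le_trans _ _ (`|t| ^+ 2)); last by rewrite real_normK ?num_real ?lerDr.
  by rewrite ler_sqr ?nnegrE //; lra.
have [tl|tl] := leP t (- L).
  by apply: (far (- L)); [rewrite ler0_norm; lra|exact: fl].
have [tr|tr] := leP (- L + n%:R * (e / 2)) t.
  by apply: (far (- L + n%:R * (e / 2))); [rewrite ger0_norm; lra|exact: fr].
apply: le_trans (fm t _) _; first by rewrite !ltW.
by rewrite mulrC divfK // ler_peMr ?lerDl ?sqr_ge0 // ltW.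
Qed.

(* The diagonal carries [min a b]; the two excesses, which have the same total
   mass, are coupled independently. *)
Lemma discrete_coupling (I : finType) (a b : I -> R) (c : I -> I -> R) (C : R) :
  (forall i, 0 <= a i) -> (forall i, 0 <= b i) -> \sum_i a i = \sum_i b i ->
  (forall i, c i i = 0) -> (forall i j, c i j <= C) ->
  exists q : I -> I -> R,
    [/\ forall i j, 0 <= q i j, forall i, \sum_j q i j = a i,
        forall j, \sum_i q i j = b j &
        \sum_i \sum_j q i j * c i j <= C * \sum_i `|a i - b i|].
Proof.
move=> a0 b0 ab c0 cC.
pose m i := Num.min (a i) (b i).
pose r := \sum_i (a i - m i).
have rb : \sum_i (b i - m i) = r by rewrite /r !big_split /= ab.
have ma i : 0 <= a i - m i by rewrite subr_ge0 ge_min lexx.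
have mb i : 0 <= b i - m i by rewrite subr_ge0 ge_min lexx orbT.
have m0 i : 0 <= m i by rewrite le_min a0 b0.
have r0 : 0 <= r by exact: sumr_ge0.
pose q i j := (i == j)%:R * m i + (a i - m i) * (b j - m j) / r.
have diag i (d : I -> R) : \sum_j (i == j)%:R * d j = d i.
  rewrite (bigD1 i) //= eqxx mul1r big1 ?addr0 // => j ji.
  by rewrite eq_sym (negbTE ji) mul0r.
(* If [r = 0] then [r / r] is 0 instead of 1, but every excess vanishes as well. *)
have rV (d : I -> R) i : (forall i, 0 <= d i) -> \sum_i d i = r -> d i * (r / r) = d i.
  move=> d0 dr; have [rE|rn0] := eqVneq r 0; last by rewrite divff ?mulr1.
  by rewrite rE in dr; rewrite (psumr_eq0P (fun i _ => d0 i) dr) // mul0r.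
exists q; split.
- move=> i j; rewrite /q addr_ge0 ?mulr_ge0 ?invr_ge0 //.
- move=> i; rewrite big_split /= (diag i (fun=> m i)) -mulr_suml -mulr_sumr rb.
  by rewrite -mulrA (rV (fun i => a i - m i)) // addrC subrK.
- move=> j; rewrite big_split /= (eq_bigr (fun i => (j == i)%:R * m i)); last first.
    by move=> i _; rewrite eq_sym.
  rewrite diag -mulr_suml -mulr_suml mulrAC mulrC.
  by rewrite -/r mulrA -mulrA (rV (fun j => b j - m j)) // addrC subrK.
- have [[i0 _]|noI] := pselect (exists i : I, True); last first.
    by rewrite !big1 ?mulr0 // => i; case: noI; exists i.
  have C0 : 0 <= C by rewrite -(c0 i0).
  apply: (@le_trans _ _ (C * r)).
    have -> : C * r = \sum_i \sum_j (a i - m i) * (b j - m j) / r * C.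
      under eq_bigr do rewrite -mulr_suml -mulr_suml -mulr_sumr rb.
      rewrite -!mulr_suml -/r mulrC; congr (_ * _).
      have [->|rn0] := eqVneq r 0; first by rewrite !mul0r.
      by rewrite mulfK.
    apply: ler_sum => i _; apply: ler_sum => j _.
    rewrite /q mulrDl; have [->|ij] := eqVneq i j.
      by rewrite c0 !mulr0 addr0 mulr_ge0 ?divr_ge0 ?mulr_ge0.
    by rewrite mul0r mul0r add0r ler_wpM2l ?divr_ge0 ?mulr_ge0.
  rewrite ler_wpM2l //; apply: ler_sum => i _.
  rewrite /m; case: (leP (a i) (b i)) => abi; first by rewrite subrr.
  exact: ler_norm.
Qed.

End RealLemmas.

(** * Inner products and Borel functions *)

Section InnerProduct.
Context {R : realType} {H : completeNormedModType R}.
Variable dot : {dot H for idfun}.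
Hypothesis norm_dot : forall x : H, `|x| = Num.sqrt (dot x x).
Implicit Types (x y u v : H) (a : R).

Lemma dotC x y : dot x y = dot y x.
Proof. by rewrite (@hermC _ false idfun _ dot) expr0 mul1r. Qed.

Lemma dotDl x y u : dot (x + y) u = dot x u + dot y u.
Proof. exact: linearDl. Qed.

Lemma dotDr x y u : dot u (x + y) = dot u x + dot u y.
Proof. exact: linearDr. Qed.

Lemma dotBl x y u : dot (x - y) u = dot x u - dot y u.
Proof. exact: linearBl. Qed.

Lemma dotBr x y u : dot u (x - y) = dot u x - dot u y.
Proof. exact: linearBr. Qed.

Lemma dotZr a x u : dot u (a *: x) = a * dot u x.
Proof. exact: linearZr_LR. Qed.

Lemma dotZl a x u : dot (a *: x) u = a * dot x u.
Proof. by rewrite dotC dotZr dotC. Qed.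

Lemma dot0r x : dot x 0 = 0.
Proof. exact: linear0r. Qed.

Lemma sqr_norm x : `|x| ^+ 2 = dot x x.
Proof.
rewrite norm_dot sqr_sqrtr //.
by have [->|/neq0_dnorm_gt0/ltW//] := eqVneq x 0; rewrite dot0r.
Qed.

Lemma sqr_normB x y : `|x - y| ^+ 2 = `|x| ^+ 2 - 2 * dot x y + `|y| ^+ 2.
Proof. by rewrite !sqr_norm dotBl !dotBr (dotC y x); ring. Qed.

Lemma sqr_normD x y : `|x + y| ^+ 2 = `|x| ^+ 2 + 2 * dot x y + `|y| ^+ 2.
Proof. by rewrite !sqr_norm dotDl !dotDr (dotC y x); ring. Qed.

Lemma dot_le x y : dot x y <= `|x| * `|y|.
Proof.
have : `|x + y| ^+ 2 <= (`|x| + `|y|) ^+ 2.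
  by rewrite ler_sqr ?nnegrE ?addr_ge0 // ler_normD.
by rewrite sqr_normD sqrrD; lra.
Qed.

Lemma norm_dot_le x y : `|dot x y| <= `|x| * `|y|.
Proof.
rewrite ler_norml dot_le andbT lerNl -mulN1r -dotZr scaleN1r.
by rewrite -(normrN y) dot_le.
Qed.

Lemma continuous_dotl u : continuous (dot^~ u).
Proof.
move=> x; apply/cvgrPdist_le => e e0.
pose d := e / (1 + `|u|).
have u1 : 0 < 1 + `|u| by rewrite ltr_pwDl.
have d0 : 0 < d by rewrite divr_gt0.
near=> y; rewrite -dotBl (le_trans (norm_dot_le _ _)) //.
have : `|x - y| <= d by near: y; exact: cvgr_dist_le.
rewrite /d ler_pdivlMr // => /(le_trans _); apply.
by rewrite ler_wpM2l // lerDr.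
Unshelve. all: by end_near. Qed.

End InnerProduct.

(** * Measurability of continuous functions and of the distance *)

Section Borel.
Context {R : realType} {H : completeNormedModType R}.

Lemma continuous_borel (f : H -> R) : continuous f ->
  measurable_fun [set: borel H] f.
Proof.
move=> /continuousP cf; apply: (measurability _ (RGenOpens.measurableE R)).
move=> _ [_ [a [b ->] <-]]; rewrite setTI; apply: sub_sigma_algebra.
exact/cf/interval_open.
Qed.

Lemma measurable_normB (a : H) :
  measurable_fun [set: borel H] (fun x : H => `|x - a|).
Proof.
apply: continuous_borel => x.
by apply: cvg_norm; apply: cvgB; [exact: cvg_id|exact: cvg_cst].
Qed.

Lemma separable_seq : separable_space H ->
  exists s : nat -> H, forall U : set H, open U -> U !=set0 -> exists k, U (s k).
Proof.
move=> [D cD dD].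
have [x0 Dx0] : D !=set0.
  by have [x [_ Dx]] := dD setT (ex_intro _ 0 I) openT; exists x.
have /(pfcard_geP)[D0|[s]] := cD; first by rewrite D0 in Dx0.
exists s => U oU U0; have [x [Ux Dx]] := dD U U0 oU.
by have [k _ sk] := 'surj_s Dx; exists k; rewrite sk.
Qed.

(** The sigma-algebra here is the product one, so continuity on the product does not suffice
    directly. For a dense sequence [s], [|x - y|] is the supremum of [|x - s k| - |y - s k|], each a
    difference of functions of one variable. *)
Lemma measurable_dist : separable_space H ->
  measurable_fun [set: (borel H * borel H)%type] (fun z => `|(z.1 : H) - z.2|).
Proof.
move=> /separable_seq[s sP].
apply: (measurability _ (RGenOInfty.measurableE R)).
move=> _ [_ [a ->] <-]; rewrite setTI.
rewrite [X in measurable X](_ : _ =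
    \bigcup_k [set z | a < `|(z.1 : H) - s k| - `|(z.2 : H) - s k|]).
  apply: bigcupT_measurable => k.
  rewrite -[X in measurable X]setTI [X in _ `&` X](_ : _ =
    (fun z : borel H * borel H => `|(z.1 : H) - s k| - `|(z.2 : H) - s k|) @^-1`
      `]a, +oo[%classic); last first.
    by apply/seteqP; split => z /=; rewrite in_itv /= andbT.
  apply: measurable_funB; try exact: measurable_itv; try exact: measurableT.
    exact: (measurableT_comp (measurable_normB _) measurable_fst).
  exact: (measurableT_comp (measurable_normB _) measurable_snd).
apply/seteqP; split => [z|z [k _]] /=; rewrite in_itv /= andbT; last first.
  move=> /lt_le_trans; apply; rewrite lerBlDr -(subrK (z.2 : H) z.1) -addrA.
  by rewrite (le_trans (ler_normD _ _)) // subrK.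
(* If [|z.2 - s k| < d], then [|z.1 - s k| - |z.2 - s k| >= |z.1 - z.2| - 2 |z.2 - s k| > a]. *)
move=> az; pose d := (`|z.1 - z.2| - a) / 2.
have d0 : 0 < d by rewrite divr_gt0 // subr_gt0.
have [|k] := sP (ball (z.2 : H) d) (ball_open _ _).
  by exists z.2; exact: (ballxx _ d0).
rewrite -ball_normE /= => zk; exists k => //=.
have := ler_distD (s k) z.1 z.2; rewrite (distrC (s k)).
by move: zk; rewrite /d; lra.
Qed.

End Borel.

(** * Functions of quadratic growth *)

Section Quadratic.
Context {R : realType} {H : completeNormedModType R}.
Implicit Types (f g : H -> R) (c : R) (mu : probability (borel H) R).

(** The test functions: they are integrable under every measure with finite second moment, so the
    real-valued integral [expect] is linear and monotone on them. *)
Definition quad_growth f := measurable_fun [set: borel H] f /\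
  exists C, forall x, `|f x| <= C * (1 + `|x| ^+ 2).

Lemma weight_ge1 (x : H) : 1 <= 1 + `|x| ^+ 2.
Proof. by rewrite lerDl. Qed.

Lemma weight_ge0 (x : H) : 0 <= 1 + `|x| ^+ 2.
Proof. by rewrite addr_ge0. Qed.

Lemma quad_le f g c : measurable_fun [set: borel H] f -> quad_growth g ->
  (forall x, `|f x| <= c * `|g x|) -> quad_growth f.
Proof.
move=> mf [_ [C gC]] fg; split => //; exists (`|c| * C) => x.
rewrite (le_trans (fg x)) // -mulrA (le_trans (y := `|c| * `|g x|)) //.
  by rewrite ler_wpM2r // ler_norm.
by rewrite ler_wpM2l.
Qed.

Lemma quad_cst c : quad_growth (fun=> c).
Proof.
split; first exact: measurable_cst.
by exists `|c| => x; rewrite ler_peMr // weight_ge1.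
Qed.

Lemma quad_bounded f c : measurable_fun [set: borel H] f ->
  (forall x, `|f x| <= c) -> quad_growth f.
Proof.
move=> mf fc; apply: (quad_le (c := c) mf (quad_cst 1)) => x.
by rewrite normr1 mulr1.
Qed.

Lemma quadD f g : quad_growth f -> quad_growth g ->
  quad_growth (fun x => f x + g x).
Proof.
move=> [mf [C fC]] [mg [D gD]]; split; first exact: measurable_funD.
exists (C + D) => x; rewrite mulrDl (le_trans (ler_normD _ _)) // lerD //.
Qed.

Lemma quadM f g c : measurable_fun [set: borel H] f -> quad_growth g ->
  (forall x, `|f x| <= c) -> quad_growth (fun x => f x * g x).
Proof.
move=> mf gq fc; apply: (quad_le (c := c) _ gq).
  by apply: measurable_funM => //; case: gq.
by move=> x; rewrite normrM ler_wpM2r.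
Qed.

Lemma quadZ f c : quad_growth f -> quad_growth (fun x => c * f x).
Proof. by move=> fq; apply: (quadM (c := `|c|)) => //; exact: measurable_cst. Qed.

Lemma quadB f g : quad_growth f -> quad_growth g ->
  quad_growth (fun x => f x - g x).
Proof.
move=> fq gq; under eq_fun do rewrite -mulN1r.
by apply: quadD => //; exact: quadZ.
Qed.

Lemma quad_sum (I : Type) (r : seq I) (P : pred I) (f : I -> H -> R) :
  (forall i, P i -> quad_growth (f i)) ->
  quad_growth (fun x => \sum_(i <- r | P i) f i x).
Proof.
move=> fq; elim: r => [|i r IH].
  by under eq_fun do rewrite big_nil; exact: quad_cst.
under eq_fun do rewrite big_cons.
by case: (boolP (P i)) => // Pi; apply: quadD => //; exact: fq.
Qed.

Lemma quad_norm f : quad_growth f -> quad_growth (fun x => `|f x|).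
Proof.
move=> fq; apply: (quad_le (c := 1) _ fq) => [|x]; last by rewrite normr_id mul1r.
by apply: measurableT_comp => //; case: fq.
Qed.

Lemma quad_sqr_normB (a : H) : quad_growth (fun x => `|x - a| ^+ 2).
Proof.
split; first by apply: measurable_funX; exact: measurable_normB.
exists (2 * (1 + `|a| ^+ 2)) => x.
rewrite ger0_norm //.
have h : `|x - a| ^+ 2 <= (`|x| + `|a|) ^+ 2.
  by rewrite ler_sqr ?nnegrE ?addr_ge0 // ler_normB.
apply: (le_trans h).
have : 0 <= (`|x| - `|a|) ^+ 2 by rewrite sqr_ge0.
have : 0 <= `|a| ^+ 2 * `|x| ^+ 2 by rewrite mulr_ge0.
nra.
Qed.

Lemma quad_sqr_norm : quad_growth (fun x => `|x| ^+ 2).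
Proof. by have := quad_sqr_normB 0; under eq_fun do rewrite subr0. Qed.

Lemma quad_weight : quad_growth (fun x => 1 + `|x| ^+ 2).
Proof. exact: quadD (quad_cst 1) quad_sqr_norm. Qed.

Definition expect mu f : R := \int[mu]_x f x.

Section Expect.
Variable mu : probability (borel H) R.
Hypothesis mu2 : finite_second_moment mu.

Lemma integrable_quad f : quad_growth f ->
  mu.-integrable [set: borel H] (EFin \o f).
Proof.
move=> [mf [C fC]].
have iw : mu.-integrable [set: borel H] (fun x : H => (1 + `|x| ^+ 2)%:E).
  have [mw _] := quad_weight.
  apply/integrableP; split; first exact/measurable_EFinP.
  under eq_integral do rewrite /= ger0_norm ?weight_ge0 // EFinD.
  rewrite ge0_integralD //; last first.
    by apply/measurable_EFinP; case: quad_sqr_norm.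
  by rewrite integral_cst // [X in (_ * X)%E]probability_setT mul1e
    lte_add_pinfty // ltry.
apply: (le_integrable measurableT _ _ (integrableZl measurableT C iw)) => //.
  exact/measurable_EFinP.
move=> x _; rewrite /= lee_fin (le_trans (fC x)) //.
by rewrite normrM (ger0_norm (weight_ge0 x)) ler_wpM2r ?weight_ge0 // ler_norm.
Qed.

Lemma expectE f : quad_growth f ->
  (\int[mu]_x (f x)%:E = (expect mu f)%:E)%E.
Proof.
move=> /integrable_quad fi; rewrite /expect /Rintegral fineK //.
exact: integrable_fin_num.
Qed.

Lemma expectD f g : quad_growth f -> quad_growth g ->
  expect mu (fun x => f x + g x) = expect mu f + expect mu g.
Proof. by move=> /integrable_quad ? /integrable_quad ?; exact: RintegralD. Qed.

Lemma expectZ f c : quad_growth f -> expect mu (fun x => c * f x) = c * expect mu f.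
Proof. by move=> /integrable_quad ?; exact: RintegralZl. Qed.

Lemma expectB f g : quad_growth f -> quad_growth g ->
  expect mu (fun x => f x - g x) = expect mu f - expect mu g.
Proof. by move=> /integrable_quad ? /integrable_quad ?; exact: RintegralB. Qed.

Lemma expect_cst c : expect mu (fun=> c) = c.
Proof. by rewrite /expect Rintegral_cst // [X in fine X]probability_setT mulr1. Qed.

Lemma expect_le f g : quad_growth f -> quad_growth g -> (forall x, f x <= g x) ->
  expect mu f <= expect mu g.
Proof. by move=> /integrable_quad ? /integrable_quad ? fg; exact: le_Rintegral. Qed.

Lemma expect_ge0 f : (forall x, 0 <= f x) -> 0 <= expect mu f.
Proof. by move=> f0; exact: Rintegral_ge0. Qed.

Lemma expect_norm f : quad_growth f -> `|expect mu f| <= expect mu (fun x => `|f x|).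
Proof. by move=> /integrable_quad ?; exact: le_normr_Rintegral. Qed.

Lemma expect_sum (I : Type) (r : seq I) (f : I -> H -> R) :
  (forall i, quad_growth (f i)) ->
  expect mu (fun x => \sum_(i <- r) f i x) = \sum_(i <- r) expect mu (f i).
Proof.
move=> fq; elim: r => [|i r IH].
  by under eq_fun do rewrite big_nil; rewrite big_nil expect_cst.
under eq_fun do rewrite big_cons; rewrite big_cons -IH expectD //.
by apply: quad_sum.
Qed.

Lemma expect_close f g c : quad_growth f -> quad_growth g ->
  (forall x, `|f x - g x| <= c * (1 + `|x| ^+ 2)) ->
  `|expect mu f - expect mu g| <= c * expect mu (fun x => 1 + `|x| ^+ 2).
Proof.
move=> fq gq fg; rewrite -expectB // (le_trans (expect_norm _)) //; first exact: quadB.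
have wq := quad_weight.
rewrite -expectZ //; apply: expect_le => //; [exact/quad_norm/quadB|exact: quadZ].
Qed.

End Expect.

End Quadratic.

(** * Trigonometric polynomials *)

Section Trig.
Context {R : realType} {H : completeNormedModType R}.
Variable dot : {dot H for idfun}.
Hypothesis norm_dot : forall x : H, `|x| = Num.sqrt (dot x x).
Implicit Types (f g : H -> R) (c : R) (u v : H).

(** The free phase [c] also provides constants and sines, so this linear span is an algebra. *)
Inductive trig : (H -> R) -> Prop :=
| trig_cos u c : trig (fun x => cos (dot x u + c))
| trigD f g : trig f -> trig g -> trig (fun x => f x + g x)
| trigZ c f : trig f -> trig (fun x => c * f x).

Lemma trig_cst c : trig (fun=> c).
Proof.
rewrite [X in trig X](_ : _ = (fun x => c * cos (dot x 0 + 0))).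
  by apply: trigZ; exact: trig_cos.
by apply/funext => x; rewrite dot0r addr0 cos0 mulr1.
Qed.

Lemma trig_sin u c : trig (fun x => sin (dot x u + c)).
Proof.
have := trig_cos u (c - pi / 2).
by under eq_fun do rewrite addrA cosBpihalf.
Qed.

Lemma trigB f g : trig f -> trig g -> trig (fun x => f x - g x).
Proof.
move=> tf tg; under eq_fun do rewrite -mulN1r.
by apply: trigD => //; exact: trigZ.
Qed.

(** By bilinearity this reduces to two cosines, where the product-to-sum formula applies. *)
Lemma trigM f g : trig f -> trig g -> trig (fun x => f x * g x).
Proof.
move=> tf tg; elim: tf => [u c|f1 f2 _ t1 _ t2|c f1 _ t1].
- elim: tg => [v d|g1 g2 _ t1 _ t2|d g1 _ t1].
  + have -> : (fun x => cos (dot x u + c) * cos (dot x v + d)) =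
      (fun x => 2^-1 * (cos (dot x (u + v) + (c + d)) + cos (dot x (u - v) + (c - d)))).
      apply/funext => x; rewrite dotDr dotBr.
      rewrite (_ : _ + _ + (c + d) = (dot x u + c) + (dot x v + d)); last by ring.
      rewrite (_ : _ - _ + (c - d) = (dot x u + c) - (dot x v + d)); last by ring.
      move: (dot x u + c) (dot x v + d) => a b.
      by rewrite cosD cosB; field.
    by apply: trigZ; apply: trigD; exact: trig_cos.
  + by under eq_fun do rewrite mulrDr; exact: trigD.
  + by under eq_fun do rewrite mulrCA; exact: trigZ.
- by under eq_fun do rewrite mulrDl; exact: trigD.
- by under eq_fun do rewrite -mulrA; exact: trigZ.
Qed.

Lemma trig_measurable f : trig f -> measurable_fun [set: borel H] f.
Proof.
elim=> [u c|f1 f2 _ m1 _ m2|c f1 _ m1].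
- apply: continuous_borel => x.
  apply: (cvg_comp (fun y => dot y u + c) cos); last exact: continuous_cos.
  by apply: cvgD; [exact: continuous_dotl|exact: cvg_cst].
- exact: measurable_funD.
- by apply: measurable_funM => //; exact: measurable_cst.
Qed.

Lemma trig_bounded f : trig f -> exists C, forall x, `|f x| <= C.
Proof.
elim=> [u c|f1 f2 _ [C1 fC1] _ [C2 fC2]|c f1 _ [C fC]].
- by exists 1 => x; exact: cos_max.
- by exists (C1 + C2) => x; rewrite (le_trans (ler_normD _ _)) ?lerD.
- by exists (`|c| * C) => x; rewrite normrM ler_wpM2l.
Qed.

Lemma quad_trig f : trig f -> quad_growth f.
Proof.
move=> tf; have [C fC] := trig_bounded tf.
exact: quad_bounded (trig_measurable tf) fC.
Qed.

Lemma measurable_dotl u : measurable_fun [set: borel H] (dot^~ u).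
Proof. by apply: continuous_borel; exact: continuous_dotl. Qed.

Lemma quad_dotl u : quad_growth (dot^~ u).
Proof.
split; first exact: measurable_dotl.
exists `|u| => x; rewrite (le_trans (norm_dot_le norm_dot _ _)) //.
rewrite mulrC ler_wpM2l //.
have : 0 <= (`|x| - 1) ^+ 2 by rewrite sqr_ge0.
nra.
Qed.

Section Convergence.
Variables (mu_ : nat -> probability (borel H) R) (nu : probability (borel H) R).
Hypothesis mu_2 : forall n, finite_second_moment (mu_ n).
Hypothesis nu2 : finite_second_moment nu.

(** The growth condition is bundled in so that the closure properties below can use linearity of
    [expect]. *)
Definition cvg_expect f :=
  quad_growth f /\ expect (mu_ n) f @[n --> \oo] --> expect nu f.

Lemma cvg_expect_cst c : cvg_expect (fun=> c).
Proof.
split; first exact: quad_cst.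
by under eq_fun do rewrite expect_cst; rewrite expect_cst; exact: cvg_cst.
Qed.

Lemma cvg_expectD f g : cvg_expect f -> cvg_expect g ->
  cvg_expect (fun x => f x + g x).
Proof.
move=> [fq fc] [gq gc]; split; first exact: quadD.
under eq_fun do rewrite expectD //; rewrite expectD //; exact: cvgD.
Qed.

Lemma cvg_expectZ c f : cvg_expect f -> cvg_expect (fun x => c * f x).
Proof.
move=> [fq fc]; split; first exact: quadZ.
by under eq_fun do rewrite expectZ //; rewrite expectZ //; exact: cvgMr.
Qed.

Lemma cvg_expectB f g : cvg_expect f -> cvg_expect g ->
  cvg_expect (fun x => f x - g x).
Proof.
move=> fE gE; under eq_fun do rewrite -mulN1r.
by apply: cvg_expectD => //; exact: cvg_expectZ.
Qed.

Lemma cvg_expect_sum (I : Type) (r : seq I) (f : I -> H -> R) :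
  (forall i, cvg_expect (f i)) -> cvg_expect (fun x => \sum_(i <- r) f i x).
Proof.
move=> tf; elim: r => [|i r IH].
  by under eq_fun do rewrite big_nil; exact: cvg_expect_cst.
by under eq_fun do rewrite big_cons; exact: cvg_expectD.
Qed.

Hypothesis cvg_sqr_norm : cvg_expect (fun x => `|x| ^+ 2).

(** Convergence of the second moments keeps the integrals of [1 + |x|^2] bounded, so an
    approximation error relative to this weight is small uniformly in [n]. *)
Lemma cvg_expect_approx f : quad_growth f ->
  (forall e, 0 < e -> exists2 g, cvg_expect g &
     forall x, `|f x - g x| <= e * (1 + `|x| ^+ 2)) -> cvg_expect f.
Proof.
move=> fq fg; split => //.
have [_ wc] := cvg_expectD (cvg_expect_cst 1) cvg_sqr_norm.
pose W := expect nu (fun x => 1 + `|x| ^+ 2).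
have W0 : 0 <= W by apply: expect_ge0 => x; exact: weight_ge0.
apply/cvgrPdist_le => e e0.
(* The three errors are at most [d * W], [d] and [d * (W + 1)], and sum to [e]. *)
pose d := e / (2 * W + 2).
have p0 : 0 < 2 * W + 2 by rewrite ltr_wpDl // mulr_ge0.
have d0 : 0 < d by rewrite divr_gt0.
have [g [gq gc] fgd] := fg d d0.
near=> n.
have h1 := expect_close (mu_2 n) fq gq fgd.
have h2 := expect_close nu2 fq gq fgd.
have h3 : `|expect nu g - expect (mu_ n) g| <= d by near: n; exact: cvgr_dist_le.
have h4 : expect (mu_ n) (fun x => 1 + `|x| ^+ 2) <= W + 1.
  have : `|W - expect (mu_ n) (fun x => 1 + `|x| ^+ 2)| <= 1.
    by near: n; exact: cvgr_dist_le.
  by rewrite distrC ler_distl => /andP[].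
have h5 : d * expect (mu_ n) (fun x => 1 + `|x| ^+ 2) <= d * (W + 1).
  by rewrite ler_pM2l.
rewrite -/W in h2.
have -> : e = d * (2 * W + 2) by rewrite /d divfK // gt_eqF.
rewrite (_ : _ - _ = (expect nu f - expect nu g) + (expect nu g - expect (mu_ n) g)
   + (expect (mu_ n) g - expect (mu_ n) f)); last by ring.
rewrite (le_trans (ler_normD _ _)) // (le_trans (lerD (ler_normD _ _) (lexx _))) //.
rewrite (distrC (expect _ g) (expect _ f)).
rewrite (le_trans (lerD (lerD h2 h3) (le_trans h1 h5))) //; lra.
Unshelve. all: by end_near. Qed.

Hypothesis cvg_ramp : forall u c, cvg_expect (fun x => Num.max 0 (dot x u + c)).

(** The functions [h] of one variable for which [h (dot x u)] has converging integrals satisfy the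
    closure hypotheses of [ramp_approx], and a shifted cosine is 1-Lipschitz and bounded by 1. *)
Lemma cvg_trig f : trig f -> cvg_expect f.
Proof.
elim=> [u c|f1 f2 _ m1 _ m2|c f1 _ m1]; last 2 first.
- exact: cvg_expectD.
- exact: cvg_expectZ.
apply: cvg_expect_approx; first exact/quad_trig/trig_cos.
move=> e e0.
(* By Cauchy-Schwarz, [1 + (x | u)^2 <= b * (1 + |x|^2)]. *)
pose b := 1 + `|u| ^+ 2.
have b0 : 0 < b by rewrite ltr_pwDl.
have d0 : 0 < e / b by rewrite divr_gt0.
pose P (h : R -> R) := cvg_expect (fun x => h (dot x u)).
have [||||||h hP hd] := @ramp_approx R P _ _ _ _ (fun t => cos (t + c)) _ _ _ d0.
- exact: cvg_expect_cst.
- exact: cvg_ramp.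
- by move=> h k; exact: cvg_expectD.
- by move=> a h; exact: cvg_expectZ.
- move=> s t; rewrite (le_trans (cos_lipschitz _ _)) //.
  by rewrite opprD addrACA subrr addr0.
- by move=> t; exact: cos_max.
exists (fun x => h (dot x u)) => // x.
apply: (le_trans (hd _)); rewrite mulrAC ler_pdivrMr // -mulrA ler_pM2l //.
have : (dot x u) ^+ 2 <= (`|x| * `|u|) ^+ 2.
  by rewrite -real_normK ?num_real // ler_sqr ?nnegrE ?mulr_ge0 // norm_dot_le.
rewrite /b exprMn mulrDl mul1r mulrDr mulr1 => h1.
have : 0 <= `|u| ^+ 2 by [].
have : 0 <= `|x| ^+ 2 by [].
nra.
Qed.

(* [sin (s t) / s] is bounded and differs from [t] by at most [s t^2], so that
   [f x * sin (s * dot x v) / s] is a trigonometric approximation. *)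
Lemma cvg_trig_dot f v : trig f -> cvg_expect (fun x => f x * dot x v).
Proof.
move=> tf; have [C fC] := trig_bounded tf.
have C0 : 0 <= C by exact: le_trans (fC 0).
apply: cvg_expect_approx.
  by apply: (quadM (c := C)) => //; [exact: trig_measurable|exact: quad_dotl].
move=> e e0.
(* The error [s * C * (x | v)^2] is at most [s * b * (1 + |x|^2)], and [s = e / b]. *)
pose b := (1 + C) * (1 + `|v| ^+ 2).
have b0 : 0 < b by rewrite mulr_gt0 // ltr_pwDl.
pose s := e / b.
have s0 : 0 < s by rewrite divr_gt0.
exists (fun x => s^-1 * (f x * sin (dot x (s *: v) + 0))).
  by apply: cvg_trig; apply: trigZ; apply: trigM => //; exact: trig_sin.
move=> x; rewrite addr0 dotZr.
have -> : f x * dot x v - s^-1 * (f x * sin (s * dot x v)) =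
    f x * (s^-1 * - (sin (s * dot x v) - s * dot x v)).
  by field; rewrite gt_eqF.
rewrite !normrM normrN (gtr0_norm (x := s^-1)) ?invr_gt0 //.
apply: (@le_trans _ _ (C * (s^-1 * (s * dot x v) ^+ 2))).
  by rewrite ler_pM // ?mulr_ge0 ?invr_ge0 ?(ltW s0) //
    ler_wpM2l ?invr_ge0 ?(ltW s0) // sin_sub_le_sqr.
have -> : C * (s^-1 * (s * dot x v) ^+ 2) = s * (C * dot x v ^+ 2).
  by field; rewrite gt_eqF.
have -> : e = s * b by rewrite /s divfK // gt_eqF.
rewrite -mulrA ler_pM2l // /b.
have h : (dot x v) ^+ 2 <= `|x| ^+ 2 * `|v| ^+ 2.
  by rewrite -exprMn -real_normK ?num_real // ler_sqr ?nnegrE ?mulr_ge0 // norm_dot_le.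
apply: (@le_trans _ _ (C * (`|x| ^+ 2 * `|v| ^+ 2))); first by rewrite ler_wpM2l.
have v0 : 0 <= `|v| ^+ 2 by [].
have x0 : 0 <= `|x| ^+ 2 by [].
rewrite [leRHS]mulrAC -mulrA.
rewrite ler_pM ?mulr_ge0 //; first by rewrite lerDr.
by rewrite ler_pM // lerDr.
Qed.

End Convergence.
End Trig.

(** * Approximation by trigonometric polynomials *)

Section Approximable.
Context {R : realType} {H : completeNormedModType R}.
Variable dot : {dot H for idfun}.
Hypothesis norm_dot : forall x : H, `|x| = Num.sqrt (dot x x).
Variable mu : probability (borel H) R.
Hypothesis mu2 : finite_second_moment mu.
Implicit Types (f g : H -> R) (c : R) (u v s : H).

Lemma expect_dominated (f_ : nat -> H -> R) (f : H -> R) (C : R) :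
  (forall n, measurable_fun [set: borel H] (f_ n)) ->
  (forall n x, `|f_ n x| <= C * (1 + `|x| ^+ 2)) ->
  (forall x, f_ n x @[n --> \oo] --> f x) ->
  expect mu (f_ n) @[n --> \oo] --> expect mu f.
Proof.
move=> mf_ fC ff.
have mf : measurable_fun [set: borel H] f.
  by apply: (measurable_fun_cvg mf_) => x _; exact: ff.
have fq : quad_growth f.
  split => //; exists C => x.
  by apply: (cvgr_to_le (cvg_norm (ff x))); exact: nearW.
have fae : {ae mu, forall x, [set: borel H] x -> (f_ n x)%:E @[n --> \oo] --> (f x)%:E}.
  by apply: aeW => x _; apply: cvg_EFin; [exact: nearW|exact: ff].
have gae : {ae mu, forall x n, [set: borel H] x ->
    (`|(f_ n x)%:E| <= (C * (1 + `|x : H| ^+ 2))%:E)%E}.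
  by apply: aeW => x n _; rewrite /= lee_fin.
have [_ _] := dominated_convergence measurableT
  (fun n => (measurable_EFinP _ _).2 (mf_ n)) ((measurable_EFinP _ _).2 mf)
  fae (integrable_quad mu2 (quadZ C quad_weight)) gae.
by rewrite (expectE mu2 fq) => /fine_cvgP[].
Qed.

Definition unit_fun f :=
  measurable_fun [set: borel H] f /\ forall x, 0 <= f x <= 1.

(** The L^1 distance for [(1 + |x|^2) dmu]. The weight controls products [f x * |x - s|^2] when [f]
    is replaced by an approximation. *)
Definition wdist f g := expect mu (fun x => `|f x - g x| * (1 + `|x| ^+ 2)).

Lemma unit_dist_le1 f g x : unit_fun f -> unit_fun g -> `|f x - g x| <= 1.
Proof.
move=> [_ /(_ x)/andP[? ?]] [_ /(_ x)/andP[? ?]].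
by rewrite ler_norml; apply/andP; split; lra.
Qed.

Lemma measurable_unit_dist f g : unit_fun f -> unit_fun g ->
  measurable_fun [set: borel H] (fun x => `|f x - g x|).
Proof.
by move=> [mf _] [mg _]; apply: measurableT_comp => //; exact: measurable_funB.
Qed.

Lemma quad_wdist f g : unit_fun f -> unit_fun g ->
  quad_growth (fun x => `|f x - g x| * (1 + `|x| ^+ 2)).
Proof.
move=> uf ug; apply: (quadM (c := 1)); first exact: measurable_unit_dist.
- exact: quad_weight.
- by move=> x; rewrite normr_id unit_dist_le1.
Qed.

Lemma wdist_le f g f1 g1 f2 g2 : unit_fun f -> unit_fun g ->
  unit_fun f1 -> unit_fun g1 -> unit_fun f2 -> unit_fun g2 ->
  (forall x, `|f x - g x| <= `|f1 x - g1 x| + `|f2 x - g2 x|) ->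
  wdist f g <= wdist f1 g1 + wdist f2 g2.
Proof.
move=> uf ug uf1 ug1 uf2 ug2 fg; rewrite /wdist -expectD //; try exact: quad_wdist.
apply: expect_le => //; try exact: quad_wdist.
  by apply: quadD; exact: quad_wdist.
by move=> x; rewrite -mulrDl ler_wpM2r // weight_ge0.
Qed.

(** Approximants are kept [0,1]-valued so that products do not amplify errors and so that they can
    serve as weights of a [mixture]. *)
Definition approximable f := unit_fun f /\
  forall e, 0 < e -> exists g, [/\ trig dot g, unit_fun g & wdist f g <= e].

Lemma approximable_trig f : trig dot f -> (forall x, 0 <= f x <= 1) -> approximable f.
Proof.
move=> tf f01; have uf : unit_fun f by split => //; exact: (trig_measurable norm_dot tf).
split => // e e0; exists f; split => //.
rewrite /wdist; under eq_fun do rewrite subrr normr0 mul0r.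
by rewrite expect_cst ltW.
Qed.

Lemma unit1B f : unit_fun f -> unit_fun (fun x => 1 - f x).
Proof.
move=> [mf f01]; split => [|x]; first by apply: measurable_funB.
by have /andP[? ?] := f01 x; apply/andP; split; lra.
Qed.

Lemma approximable1B f : approximable f -> approximable (fun x => 1 - f x).
Proof.
move=> [uf fe]; split => [|e e0]; first exact: unit1B.
have [g [tg ug gf]] := fe e e0.
exists (fun x => 1 - g x); split; [|exact: unit1B|].
  by apply: trigB => //; exact: trig_cst.
rewrite (le_trans _ gf) // /wdist le_eqVlt; apply/orP; left; apply/eqP.
congr (expect _ _); apply/funext => x; congr (_ * _).
by rewrite opprB addrCA addrAC subrr add0r distrC.
Qed.

Lemma unitM f g : unit_fun f -> unit_fun g -> unit_fun (fun x => f x * g x).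
Proof.
move=> [mf f01] [mg g01]; split => [|x]; first exact: measurable_funM.
have /andP[f0 f1] := f01 x; have /andP[g0 g1] := g01 x.
by rewrite mulr_ge0 // mulr_ile1.
Qed.

Lemma approximableM f g : approximable f -> approximable g ->
  approximable (fun x => f x * g x).
Proof.
move=> [uf fe] [ug ge]; split => [|e e0]; first exact: unitM.
have e20 : 0 < e / 2 by rewrite divr_gt0.
have [f' [tf uf' ff]] := fe _ e20; have [g' [tg ug' gg]] := ge _ e20.
exists (fun x => f' x * g' x); split; [exact: trigM|exact: unitM|].
rewrite [e]splitr; apply: le_trans (lerD ff gg).
apply: wdist_le => //; try exact: unitM.
move=> x; have -> : f x * g x - f' x * g' x = (f x - f' x) * g x + f' x * (g x - g' x).
  by ring.
rewrite (le_trans (ler_normD _ _)) // !normrM.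
have [_ /(_ x)/andP[g0 g1]] := ug; have [_ /(_ x)/andP[f0 f1]] := uf'.
by rewrite (ger0_norm g0) (ger0_norm f0) lerD // ?ler_piMr // ler_piMl.
Qed.

Lemma approximableX f n : approximable f -> approximable (fun x => f x ^+ n).
Proof.
move=> af; elim: n => [|n IH].
  by apply: approximable_trig; [exact: trig_cst|move=> x; rewrite expr0 ler01 lexx].
by under eq_fun do rewrite exprS; exact: approximableM.
Qed.

(** Dominated convergence with the weight as dominating function makes some [f_ N] close to [f]; an
    approximant of [f_ N] then serves for [f]. *)
Lemma approximable_lim (f_ : nat -> H -> R) f : (forall n, approximable (f_ n)) ->
  (forall x, f_ n x @[n --> \oo] --> f x) -> approximable f.
Proof.
move=> af ff.
have uf : unit_fun f.
  split.
    by apply: (measurable_fun_cvg (fun n => (af n).1.1)) => x _; exact: ff.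
  move=> x; apply/andP; split.
    apply: (cvgr_to_ge (ff x)); apply: nearW => n.
    by have [[_ /(_ x)/andP[]]] := af n.
  apply: (cvgr_to_le (ff x)); apply: nearW => n.
  by have [[_ /(_ x)/andP[]]] := af n.
split => // e e0.
have ud : wdist f (f_ n) @[n --> \oo] --> 0.
  rewrite -[X in _ --> X](expect_cst mu 0).
  apply: (expect_dominated (C := 1)) => [k|k x|x].
  - by case: (quad_wdist uf (af k).1).
  - rewrite mul1r normrM normr_id (ger0_norm (weight_ge0 x)).
    by rewrite ler_piMl ?weight_ge0 // unit_dist_le1 //; exact: (af k).1.
  - rewrite -[X in _ --> X](mul0r (1 + `|x| ^+ 2)) -(normr0 R) -(subrr (f x)).
    by apply: cvgMl; apply: cvg_norm; apply: cvgB; [exact: cvg_cst|exact: ff].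
have e20 : 0 < e / 2 by rewrite divr_gt0.
have /cvgrPdist_le /(_ _ e20)[N _ /(_ N (leqnn N))] := ud.
rewrite sub0r normrN => /(le_trans (ler_norm _)) dN.
have [g [tg ug fg]] := (af N).2 _ e20.
exists g; split => //; rewrite [e]splitr; apply: le_trans (lerD dN fg).
apply: wdist_le => //; try exact: (af N).1.
by move=> x; exact: ler_distD.
Qed.

(** The step polynomials of [cvg_step_poly] are composed of powers and complements only, so they
    stay in the class. *)
Lemma approximable_lt_half f : approximable f ->
  approximable (fun x => (f x < 2^-1)%R%:R).
Proof.
move=> af.
apply: (approximable_lim (f_ := fun n x => (1 - f x ^+ n) ^+ (n * 2 ^ n))).
  by move=> n; apply: approximableX; apply: approximable1B; exact: approximableX.
move=> x; have := cvg_step_poly (af.1.2 x).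
by case: ifP.
Qed.

(** On (-pi, pi) the sine has the sign of its argument. As [w n x] tends to 0, [sin (w n x) < 0]
    eventually decides [dot x u < c], and it is the condition [(1 + sin (w n x)) / 2 < 1/2] on a
    trigonometric polynomial. *)
Lemma approximable_halfspace u c : approximable (fun x => (dot x u < c)%R%:R).
Proof.
pose w n (x : H) : R := (dot x u - c) / n.+1%:R.
apply: (approximable_lim (f_ := fun n x => (sin (w n x) < 0)%R%:R)).
  move=> n.
  have -> : (fun x => (sin (w n x) < 0)%R%:R) =
     (fun x => ((1 + sin (dot x (n.+1%:R^-1 *: u) + - (c / n.+1%:R))) / 2
        < 2^-1)%R%:R) :> (H -> R).
    apply/funext => x; rewrite dotZr /w; congr (nat_of_bool _)%:R.
    rewrite mulrBl [dot x u / _]mulrC; move: (sin _) => t.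
    by apply/idP/idP; lra.
  apply: approximable_lt_half; apply: approximable_trig.
    have -> : (fun x => (1 + sin (dot x (n.+1%:R^-1 *: u) + - (c / n.+1%:R))) / 2) =
     (fun x => 2^-1 * (1 + sin (dot x (n.+1%:R^-1 *: u) + - (c / n.+1%:R)))) :> (H -> R).
      by apply/funext => x; rewrite mulrC.
    by apply: trigZ; apply: trigD; [exact: trig_cst|exact: trig_sin].
  move=> x; have := sin_le1 (dot x (n.+1%:R^-1 *: u) + - (c / n.+1%:R)).
  have := sin_geN1 (dot x (n.+1%:R^-1 *: u) + - (c / n.+1%:R)).
  by move=> h1 h2; apply/andP; split; lra.
move=> x; apply: cvg_near_cst.
have wc : w n x @[n --> \oo] --> 0.
  rewrite -[X in _ --> X](mulr0 (dot x u - c)); apply: cvgMr; exact: cvg_harmonic.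
have pi0 := pi_gt0 R.
near=> n.
have wpi : `|w n x| < pi by near: n; exact: cvgr0_norm_lt.
move: wpi; rewrite ltr_norml => /andP[wl wr].
have n0 : 0 < n.+1%:R^-1 :> R by rewrite invr_gt0.
have [xc|cx] := ltP (dot x u) c.
  have w0 : w n x < 0 by rewrite /w pmulr_llt0 // subr_lt0.
  rewrite -[w n x]opprK sinN oppr_lt0 sin_gt0_pi // oppr_gt0 w0 /=.
  by rewrite ltrNl.
have w0 : 0 <= w n x by rewrite /w mulr_ge0 ?subr_ge0 ?(ltW n0).
by rewrite ltNge sin_ge0_pi // w0 ltW.
Unshelve. all: by end_near. Qed.

(** The finite products of the indicators are eventually constant at each point. *)
Lemma approximable_bigcap (p : nat -> H -> bool) (q : H -> bool) :
  (forall k, approximable (fun x => (p k x)%:R)) ->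
  (forall x, q x <-> forall k, p k x) -> approximable (fun x => (q x)%:R).
Proof.
move=> ap qp.
apply: (approximable_lim (f_ := fun n x => \prod_(k < n) (p k x)%:R)).
  elim=> [|n IH].
    under eq_fun do rewrite big_ord0.
    by apply: approximable_trig; [exact: trig_cst|move=> x; rewrite ler01 lexx].
  by under eq_fun do rewrite big_ord_recr; exact: approximableM.
move=> x; apply: cvg_near_cst.
have [qx|/negP nqx] := boolP (q x).
  by apply: nearW => n; rewrite big1 // => k _; rewrite (qp x).1.
have [k /negP pk] : exists k, ~ p k x.
  by apply/existsNP => h; apply: nqx; apply/qp.
near=> n; have kn : (k < n)%N by near: n; exists k.+1.
by rewrite (bigD1 (Ordinal kn)) //= (negbTE pk) mul0r.
Unshelve. all: by end_near. Qed.

(** The closed ball is the intersection of the half-spaces [(x - s | u k) <= r * |u k|] over a dense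
    sequence [u]: Cauchy-Schwarz gives one inclusion, a [u k] close to [x - s] the other. *)
Lemma approximable_ball (sepH : separable_space H) s (r : R) : 0 <= r ->
  approximable (fun x => (`|x - s| <= r)%R%:R).
Proof.
move=> r0; have [u uP] := separable_seq sepH.
apply: (approximable_bigcap (p := fun k x => dot (x - s) (u k) <= r * `|u k|)).
  (* A closed half-space is the complement of an open one with opposite normal. *)
  move=> k; have := approximable1B
    (approximable_halfspace (- u k) (- (r * `|u k| + dot s (u k)))).
  congr (approximable _); apply/funext => x.
  rewrite -[- u k]scaleN1r dotZr mulN1r ltrN2 dotBl lerBlDr.
  by case: ltP => _; rewrite ?subrr ?subr0.
move=> x; split => [xr k|xk].
  by rewrite (le_trans (dot_le norm_dot _ _)) // ler_wpM2r.
rewrite leNgt; apply/negP => rx.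
pose y := x - s; have y0 : 0 < `|y| by exact: le_lt_trans rx.
(* Violating the inequality requires [(|y| + r) * |y - u k| < (|y| - r) * |y|], which
   [|y - u k| < d] ensures. *)
pose d := (`|y| - r) * `|y| / (`|y| + r + 1).
have d0 : 0 < d by rewrite divr_gt0 ?mulr_gt0 ?subr_gt0 // ltr_wpDl // addr_ge0.
have [|k] := uP (ball y d) (ball_open _ _); first by exists y; exact: (ballxx _ d0).
rewrite -ball_normE /= => yk; have := xk k; rewrite -/y leNgt => /negP; apply.
have h1 : dot y (u k) >= `|y| ^+ 2 - `|y| * `|y - u k|.
  rewrite (_ : u k = y - (y - u k)); last by rewrite opprB addrC subrK.
  rewrite dotBr (sqr_norm norm_dot) lerB // (le_trans (dot_le norm_dot _ _)) //.
  by rewrite opprB addrCA subrr addr0.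
have h2 : `|u k| <= `|y| + `|y - u k|.
  by have := ler_normB y (y - u k); rewrite opprB addrC subrK.
have h3 : r * `|u k| <= r * (`|y| + `|y - u k|) by rewrite ler_wpM2l.
have h4 : (`|y| + r + 1) * `|y - u k| < (`|y| - r) * `|y|.
  have c0 : 0 < `|y| + r + 1 by rewrite ltr_wpDl // addr_ge0.
  by rewrite mulrC -ltr_pdivlMr.
have := normr_ge0 (y - u k).
nra.
Qed.

End Approximable.

(** * Mixtures of squared distances *)

Section Mixture.
Context {R : realType} {H : completeNormedModType R}.
Variable dot : {dot H for idfun}.
Hypothesis norm_dot : forall x : H, `|x| = Num.sqrt (dot x x).
Implicit Types (f g W V : H -> R) (c : R) (u v s : H).

(** The functions [sum_i phi i x * |x - s i|^2] with a trigonometric partition of unity, built one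
    centre at a time: the new centre [s] takes the fraction [f x] and the older ones share the rest,
    starting from the single centre 0. *)
Inductive mixture : (H -> R) -> Prop :=
| mixture0 : mixture (fun x => `|x| ^+ 2)
| mixtureS f s W : trig dot f -> (forall x, 0 <= f x <= 1) -> mixture W ->
    mixture (fun x => f x * `|x - s| ^+ 2 + (1 - f x) * W x).

Lemma mixture_family W : mixture W ->
  exists n (phi : 'I_n -> H -> R) (s : 'I_n -> H),
    [/\ forall i, trig dot (phi i), forall i x, 0 <= phi i x,
        forall x, \sum_i phi i x = 1 &
        forall x, W x = \sum_i phi i x * `|x - s i| ^+ 2].
Proof.
elim=> [|f s {}W tf f01 _ [n [phi [t [tphi phi0 phi1 WE]]]]].
  exists 1%N, (fun _ _ => 1), (fun=> 0); split => [_|_ _|x|x].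
  - exact: trig_cst.
  - by [].
  - by rewrite big_ord1.
  - by rewrite big_ord1 subr0 mul1r.
exists n.+1, (fun i x => if unlift ord0 i is Some j then (1 - f x) * phi j x else f x),
  (fun i => if unlift ord0 i is Some j then t j else s); split => [i|i x|x|x].
- case: unliftP => // j _; apply: trigM => //; apply: trigB => //; exact: trig_cst.
- have /andP[f0 f1] := f01 x.
  by case: unliftP => // j _; rewrite mulr_ge0 // subr_ge0.
- rewrite big_ord_recl unlift_none; under eq_bigr do rewrite liftK.
  by rewrite -mulr_sumr phi1 mulr1 addrC subrK.
- rewrite big_ord_recl unlift_none; under eq_bigr do rewrite liftK -mulrA.
  by rewrite -mulr_sumr WE.
Qed.

Lemma quad_step f s V : unit_fun f -> quad_growth V ->
  quad_growth (fun x => f x * `|x - s| ^+ 2 + (1 - f x) * V x).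
Proof.
move=> uf qV; have uf' := unit1B uf.
have unit_norm h : unit_fun h -> forall x, `|h x| <= 1.
  by move=> [_ h01] x; have /andP[? ?] := h01 x; rewrite ger0_norm.
by apply: quadD; [apply: (quadM uf.1 (quad_sqr_normB s)); exact: unit_norm|
  apply: (quadM uf'.1 qV); exact: unit_norm].
Qed.

Lemma trig_unit f : trig dot f -> (forall x, 0 <= f x <= 1) -> unit_fun f.
Proof. by move=> tf; split => //; exact: (trig_measurable norm_dot tf). Qed.

Lemma mixture_quad W : mixture W -> quad_growth W.
Proof.
elim=> [|f s {}W tf f01 _ qW]; first exact: quad_sqr_norm.
by apply: quad_step => //; exact: trig_unit.
Qed.

Section Approximation.
Variable mu : probability (borel H) R.
Hypothesis mu2 : finite_second_moment mu.

Definition mixture_limit V := quad_growth V /\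
  forall e, 0 < e -> exists2 W, mixture W & expect mu (fun x => `|V x - W x|) <= e.

(** The error splits as [(f - g) (|x - s|^2 - W) + (1 - f) (V - W)]. Choosing [W] first fixes the
    growth constant [C] of [|x - s|^2 - W], after which [g] is chosen close to [f] in terms of
    [C]. *)
Lemma mixture_limitS f s V : approximable dot mu f -> mixture_limit V ->
  mixture_limit (fun x => f x * `|x - s| ^+ 2 + (1 - f x) * V x).
Proof.
move=> [uf af] [qV mV]; split => [|e e0]; first exact: quad_step.
have e20 : 0 < e / 2 by rewrite divr_gt0.
have [W mW VW] := mV _ e20.
have qW := mixture_quad mW.
have [_ [C0 WC0]] := quadB (quad_sqr_normB s) qW.
pose C := Num.max 0 C0.
have C_ge0 : 0 <= C by rewrite le_max lexx.
have WC x : `| `|x - s| ^+ 2 - W x| <= C * (1 + `|x| ^+ 2).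
  by rewrite (le_trans (WC0 x)) // ler_wpM2r ?weight_ge0 // le_max lexx orbT.
have d0 : 0 < e / 2 / (C + 1) by rewrite divr_gt0 // ltr_wpDl.
have [g [tg ug fg]] := af _ d0.
exists (fun x => g x * `|x - s| ^+ 2 + (1 - g x) * W x).
  by apply: mixtureS => //; exact: ug.2.
have qd := quad_wdist uf ug.
have qVW := quad_norm (quadB qV qW).
apply: (@le_trans _ _ (C * wdist mu f g + expect mu (fun x => `|V x - W x|))).
  rewrite /wdist -(expectZ mu2) // -(expectD mu2) //; last exact: quadZ.
  apply: (expect_le mu2); first by apply/quad_norm/quadB; exact: quad_step.
    by apply: quadD => //; exact: quadZ.
  move=> x.
  have -> : f x * `|x - s| ^+ 2 + (1 - f x) * V x -
      (g x * `|x - s| ^+ 2 + (1 - g x) * W x) =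
      (f x - g x) * (`|x - s| ^+ 2 - W x) + (1 - f x) * (V x - W x) by ring.
  rewrite (le_trans (ler_normD _ _)) // !normrM lerD //.
    by rewrite mulrCA ler_wpM2l.
  have /andP[? ?] := (unit1B uf).2 x.
  by rewrite ler_piMl // ger0_norm.
rewrite [leRHS]splitr lerD // (le_trans (ler_wpM2l C_ge0 fg)) //.
by rewrite mulrCA ler_piMr ?(ltW e20) // ler_pdivrMr ?mul1r ?ler_wpDr // ltr_wpDl.
Qed.

(** Squared distance from [x] to its assigned centre: the last of the first [n] points of [s] within
    distance [r], or 0 if there is none. *)
Fixpoint greedy (s : nat -> H) (r : R) n (x : H) : R :=
  if n is n'.+1 then
    (`|x - s n'| <= r)%R%:R * `|x - s n'| ^+ 2 +
    (1 - (`|x - s n'| <= r)%R%:R) * greedy s r n' x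
  else `|x| ^+ 2.

(** The greedy cost is at most [r^2] except where [x] is far from the first [n] points of a dense
    sequence; there it is [|x|^2], and this region shrinks to the empty set. *)
Lemma small_mixture (sepH : separable_space H) e : 0 < e ->
  exists2 W, mixture W & expect mu W <= e.
Proof.
move=> e0; have [s sP] := separable_seq sepH.
(* The radius, the excess [Z N] and the approximation of [V N] by a mixture contribute [e / 4]
   each. *)
pose r := Num.sqrt (e / 4).
have r0 : 0 < r by rewrite sqrtr_gt0 divr_gt0.
have r2 : r ^+ 2 = e / 4 by rewrite sqr_sqrtr // ltW // divr_gt0.
pose V n x := greedy s r n x.
have V0 n x : 0 <= V n x.
  elim: n => [|n IH]; first exact: sqr_ge0.
  by rewrite /V /=; case: (leP `|x - s n| r) => _ /=;
    rewrite ?subrr ?subr0 ?mul1r ?mul0r ?addr0 ?add0r.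
have Vcase n x : (V n x <= r ^+ 2) \/
    (V n x = `|x| ^+ 2 /\ forall k, (k < n)%N -> r < `|x - s k|).
  elim: n => [|n [IH|[IH1 IH2]]]; first by right.
    left; rewrite /V /=; case: (leP `|x - s n| r) => xr /=.
      by rewrite subrr mul1r mul0r addr0 ler_sqr ?nnegrE // ltW.
    by rewrite subr0 mul1r mul0r add0r.
  rewrite /V /=; case: (leP `|x - s n| r) => xr /=.
    by left; rewrite subrr mul1r mul0r addr0 ler_sqr ?nnegrE // ltW.
  right; rewrite subr0 mul1r mul0r add0r; split => // k.
  by rewrite ltnS leq_eqVlt => /predU1P[->|/IH2].
have mV n : mixture_limit (V n).
  elim: n => [|n IH].
    split => [|d d0]; first exact: quad_sqr_norm.
    exists (fun x => `|x| ^+ 2); first exact: mixture0.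
    rewrite (_ : (fun x => _) = fun=> 0) ?expect_cst ?ltW //.
    by apply/funext => x; rewrite /V /= subrr normr0.
  apply: mixture_limitS => //; apply: (approximable_ball norm_dot mu2 sepH).
  exact: ltW.
(* [Z n] is the excess of the cost over [r^2]; it is eventually 0 at each point and dominated by the
   weight. *)
pose Z n x := V n x - Num.min (V n x) (r ^+ 2).
have mZ n : measurable_fun [set: borel H] (Z n).
  have [[mVn _] _] := mV n.
  by apply: measurable_funB => //; apply: measurable_minr.
have Zlim x : Z n x @[n --> \oo] --> (0 : R).
  apply: cvg_near_cst.
  have [|k] := sP (ball x r) (ball_open _ _); first by exists x; exact: (ballxx _ r0).
  rewrite -ball_normE /= => xk; near=> n.
  have kn : (k < n)%N by near: n; exists k.+1.
  have [Vr|[_ /(_ k kn)]] := Vcase n x; first by rewrite /Z min_l // subrr.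
  by move=> /lt_trans /(_ xk); rewrite ltxx.
have ZE : expect mu (Z n) @[n --> \oo] --> (0 : R).
  rewrite -[X in _ --> X](expect_cst mu 0).
  apply: (expect_dominated mu2 (C := 1)) => // n x.
  rewrite mul1r; have Z0 : 0 <= Z n x by rewrite subr_ge0 ge_min lexx.
  have r20 := sqr_ge0 r; rewrite ger0_norm //.
  have [Vr|[Vx _]] := Vcase n x; first by rewrite /Z min_l // subrr weight_ge0.
  rewrite /Z Vx; have x0 : 0 <= `|x| ^+ 2 by [].
  have : 0 <= Num.min (`|x| ^+ 2) (r ^+ 2) by rewrite le_min x0 r20.
  lra.
have e40 : 0 < e / 4 by rewrite divr_gt0.
have /cvgrPdist_le /(_ _ e40)[N _ /(_ N (leqnn N))] := ZE.
rewrite sub0r normrN => /(le_trans (ler_norm _)) ZN.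
have [qV /(_ _ e40)[W mW VW]] := mV N.
exists W => //.
have qW := mixture_quad mW.
have qZ : quad_growth (Z N).
  apply: (quad_le (c := 1) _ qV) => // x; rewrite mul1r !ger0_norm //.
    by rewrite /Z gerBl le_min V0 sqr_ge0.
  by rewrite subr_ge0 ge_min lexx.
have qVW := quad_norm (quadB qV qW).
have -> : e = e / 4 + e / 4 + e / 4 + e / 4 by field.
apply: (@le_trans _ _ (expect mu (fun x => `|V N x - W x| + (Z N x + r ^+ 2)))).
  apply: (expect_le mu2) => //.
    by apply: quadD => //; apply: quadD => //; exact: quad_cst.
  move=> x; have : `|V N x - W x| >= - (V N x - W x) by rewrite lerNl lerNnormlW.
  have : Num.min (V N x) (r ^+ 2) <= r ^+ 2 by rewrite ge_min lexx orbT.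
  rewrite /Z; lra.
rewrite (expectD mu2) //; last by apply: quadD => //; exact: quad_cst.
rewrite (expectD mu2) //; last exact: quad_cst.
by rewrite expect_cst r2; lra.
Unshelve. all: by end_near. Qed.

End Approximation.
End Mixture.

(** * Couplings of mixtures *)

Section DensityMeasure.
Local Open Scope ereal_scope.
Context d (T : measurableType d) (R : realType).
Variables (m : {measure set T -> \bar R}) (k : T -> R).
Hypotheses (mk : measurable_fun setT k) (k0 : forall x, (0 <= k x)%R).

(* The two proofs are arguments so that the measure structure is found by
   unification. *)
Definition density_measure of measurable_fun setT k & (forall x, (0 <= k x)%R) :=
  fun A : set T => \int[m]_(x in A) (k x)%:E.

Local Notation dens := (density_measure mk k0).

Let dens0 : dens set0 = 0.
Proof. exact: integral_set0. Qed.

Let dens_ge0 A : 0 <= dens A.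
Proof. by apply: integral_ge0 => x _; rewrite lee_fin. Qed.

Let dens_sigma_additive : semi_sigma_additive dens.
Proof.
move=> F mF tF mUF; rewrite [X in _ --> X](_ : _ = \sum_(n <oo) dens (F n)).
  by apply: is_cvg_nneseries => n _ _; exact: dens_ge0.
rewrite /density_measure ge0_integral_bigcup // => [|x _]; last by rewrite lee_fin.
by apply/measurable_funTS/measurable_EFinP.
Qed.

HB.instance Definition _ := isMeasure.Build _ _ _ dens
  dens0 dens_ge0 dens_sigma_additive.

Import HBNNSimple.

(** Monotone convergence along simple functions reduces both sides to indicators of level sets,
    where the equality is the definition of the density measure. *)
Lemma ge0_integral_density (f : T -> R) : measurable_fun setT f ->
  (forall x, (0 <= f x)%R) ->
  \int[dens]_x (f x)%:E = \int[m]_x (f x * k x)%:E.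
Proof.
move=> mf f0.
have mEf : measurable_fun setT (EFin \o f) by exact/measurable_EFinP.
pose h := nnsfun_approx measurableT mEf.
have hf x : (h n x)%:E @[n --> \oo] --> (f x)%:E.
  by apply: (@cvg_nnsfun_approx _ _ _ _ measurableT _ mEf) => // y _; rewrite /= lee_fin.
have h_nd x a b : (a <= b)%N -> (h a x <= h b x)%R.
  by move=> ab; exact/lefP/nd_nnsfun_approx.
have -> : \int[dens]_x (f x)%:E = limn (fun n => \int[dens]_x (h n x)%:E).
  rewrite -monotone_convergence //.
  - by apply: eq_integral => x _; apply/esym/cvg_lim => //; exact: hf.
  - by move=> n; exact/measurable_EFinP.
  - by move=> n x _; rewrite lee_fin.
  - by move=> x _ a b ab; rewrite lee_fin h_nd.
have -> : \int[m]_x (f x * k x)%:E = limn (fun n => \int[m]_x (h n x * k x)%:E).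
  rewrite -monotone_convergence //.
  - apply: eq_integral => x _; apply/esym/cvg_lim => //.
    by under eq_fun do rewrite EFinM; rewrite EFinM; apply: cvgeZr => //; exact: hf.
  - by move=> n; apply/measurable_EFinP/measurable_funM.
  - by move=> n x _; rewrite lee_fin mulr_ge0.
  - by move=> x _ a b ab; rewrite lee_fin ler_wpM2r // h_nd.
congr (limn _); apply/funext => n /=.
pose hy y x : R := (y * \1_(h n @^-1` [set y]) x)%R.
have hE x : (h n x)%:E = \sum_(y \in range (h n)) (hy y x)%:E.
  by rewrite fimfunE -fsumEFin.
have mhy y : measurable_fun setT (hy y) by exact: measurable_funM.
have hkE x : (h n x * k x)%:E = \sum_(y \in range (h n)) (hy y x * k x)%:E.
  by rewrite fimfunE mulr_fsuml -fsumEFin.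
rewrite (eq_integral _ _ (fun x _ => hE x)).
rewrite [RHS](eq_integral _ _ (fun x _ => hkE x)).
have hy0 y x : (0 <= hy y x)%R by rewrite -lee_fin nnfun_muleindic_ge0.
rewrite ge0_integral_fsum //; last 2 first.
  by move=> y; exact/measurable_EFinP.
  by move=> y x _; rewrite lee_fin.
rewrite ge0_integral_fsum //; last 2 first.
  by move=> y; apply/measurable_EFinP/measurable_funM.
  by move=> y x _; rewrite lee_fin mulr_ge0.
apply: eq_fsbigr => y; rewrite inE => -[z _ hz].
have y0 : (0 <= y)%R by rewrite -hz.
under eq_integral do rewrite EFinM.
under [RHS]eq_integral do rewrite -mulrA EFinM.
rewrite !ge0_integralZl_EFin //.
- rewrite integral_indic // setIT; congr (_ * _).
  rewrite /= /density_measure integral_mkcond; apply: eq_integral => x _.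
  by rewrite patchE indicE; case: ifP => _; rewrite ?mul1r ?mul0r.
- by move=> x _; rewrite lee_fin mulr_ge0.
- exact/measurable_EFinP/measurable_funM.
- exact/measurable_EFinP.
Qed.

End DensityMeasure.

(** * Integrals of sums of tensor products *)

Section ProductIntegral.
Context {R : realType} {H : completeNormedModType R}.
Variables mu nu : probability (borel H) R.
Hypotheses (mu2 : finite_second_moment mu) (nu2 : finite_second_moment nu).

Lemma measurable_tensor (f g : H -> R) : measurable_fun [set: borel H] f ->
  measurable_fun [set: borel H] g ->
  measurable_fun [set: (borel H * borel H)%type] (fun z => f z.1 * g z.2).
Proof.
move=> mf mg; apply: measurable_funM.
  exact: (measurableT_comp mf measurable_fst).
exact: (measurableT_comp mg measurable_snd).
Qed.

Lemma integral_tensor (f g : H -> R) : quad_growth f -> quad_growth g ->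
  (forall x, 0 <= f x) -> (forall x, 0 <= g x) ->
  (\int[mu \x nu]_z (f z.1 * g z.2)%:E = (expect mu f * expect nu g)%:E)%E.
Proof.
move=> fq gq f0 g0.
rewrite fubini_tonelli1; last 2 first.
- by apply/measurable_EFinP; exact: (measurable_tensor fq.1 gq.1).
- by move=> z; rewrite lee_fin mulr_ge0.
rewrite /fubini_F /=.
have mg : measurable_fun [set: borel H] (EFin \o g).
  by apply/measurable_EFinP; case: gq.
have mf : measurable_fun [set: borel H] (EFin \o f).
  by apply/measurable_EFinP; case: fq.
transitivity (\int[mu]_x ((expect nu g)%:E * (f x)%:E))%E.
  apply: eq_integral => x _.
  under eq_integral do rewrite EFinM.
  rewrite ge0_integralZl_EFin // => [|y _]; last by rewrite lee_fin.
  by rewrite (expectE nu2 gq) muleC.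
rewrite ge0_integralZl_EFin //.
- by rewrite (expectE mu2 fq) muleC -EFinM.
- by move=> x _; rewrite lee_fin.
- exact: expect_ge0.
Qed.

Lemma integral_sum_tensor (P : finType) (w : P -> R) (f g : P -> H -> R) :
  (forall p, 0 <= w p) ->
  (forall p, quad_growth (f p)) -> (forall p, quad_growth (g p)) ->
  (forall p x, 0 <= f p x) -> (forall p x, 0 <= g p x) ->
  (\int[mu \x nu]_z (\sum_p w p * (f p z.1 * g p z.2))%:E =
    (\sum_p w p * (expect mu (f p) * expect nu (g p)))%:E)%E.
Proof.
move=> w0 fq gq f0 g0.
have mfg p : measurable_fun [set: (borel H * borel H)%type] (fun z => f p z.1 * g p z.2).
  exact: (measurable_tensor (fq p).1 (gq p).1).
under eq_integral do rewrite -sumEFin.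
rewrite ge0_integral_sum //; last 2 first.
- by move=> p; apply/measurable_EFinP/measurable_funM => //; exact: measurable_cst.
- by move=> p z _; rewrite lee_fin !mulr_ge0.
rewrite -sumEFin; apply: eq_bigr => p _.
under eq_integral do rewrite EFinM.
rewrite ge0_integralZl_EFin //.
- by rewrite integral_tensor // -EFinM.
- by move=> z _; rewrite lee_fin mulr_ge0.
- exact/measurable_EFinP.
Qed.

End ProductIntegral.

(** * The coupling built from a partition of unity *)

Section MixtureCoupling.
Context {R : realType} {H : completeNormedModType R}.
Variables mu nu : probability (borel H) R.
Hypotheses (mu2 : finite_second_moment mu) (nu2 : finite_second_moment nu).
Hypothesis sepH : separable_space H.
Variables (n : nat) (phi : 'I_n -> H -> R) (s : 'I_n -> H).
Hypotheses (mphi : forall i, measurable_fun [set: borel H] (phi i))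
  (phi0 : forall i x, 0 <= phi i x) (phi1 : forall x, \sum_i phi i x = 1).

Let a i := expect mu (phi i).
Let b i := expect nu (phi i).
Let I : finType := 'I_n.

Let phi_le1 i x : `|phi i x| <= 1.
Proof.
rewrite ger0_norm // -(phi1 x) (bigD1 i) //= lerDl.
exact: sumr_ge0.
Qed.

Let qphi i : quad_growth (phi i).
Proof. exact: (quad_bounded (mphi i) (phi_le1 i)). Qed.

Let qphiM i f : quad_growth f -> quad_growth (fun x => phi i x * f x).
Proof. by move=> fq; apply: (quadM (mphi i) fq (phi_le1 i)). Qed.

(** The coupling has density [sum_(i,j) q i j / (a i * b j) * phi i x * phi j y] with respect to the
    product measure, where [q] is a discrete coupling of the masses. Its cost is bounded through [|x
    - y|^2 <= 3 (|x - s i|^2 + |s i - s j|^2 + |y - s j|^2)]. *)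
Lemma mixture_coupling : exists2 pi : probability (borel H * borel H)%type R,
  coupling mu nu pi &
  (\int[pi]_z (`|(z.1 : H) - z.2| ^+ 2)%:E <=
    (3 * expect mu (fun x => \sum_i phi i x * `|x - s i| ^+ 2) +
     3 * expect nu (fun x => \sum_i phi i x * `|x - s i| ^+ 2) +
     3 * ((\sum_i \sum_j `|s i - s j| ^+ 2) * \sum_i `|a i - b i|))%:E)%E.
Proof.
have a0 i : 0 <= a i by exact: expect_ge0.
have b0 i : 0 <= b i by exact: expect_ge0.
have suma : \sum_i a i = 1.
  rewrite -(expect_sum mu2) // -[RHS](expect_cst mu 1); congr (expect _ _).
  exact/funext.
have sumb : \sum_i b i = 1.
  rewrite -(expect_sum nu2) // -[RHS](expect_cst nu 1); congr (expect _ _).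
  exact/funext.
pose c (i j : I) := `|s i - s j| ^+ 2.
pose C := \sum_i \sum_j c i j.
have c0 i j : 0 <= c i j by exact: sqr_ge0.
have cii i : c i i = 0 by rewrite /c subrr normr0 expr0n.
have cC i j : c i j <= C.
  rewrite /C (bigD1 i) //= (bigD1 j) //= -addrA lerDl addr_ge0 //.
    exact: sumr_ge0.
  by apply: sumr_ge0 => k _; exact: sumr_ge0.
have [q [q0 qa qb qC]] := discrete_coupling a0 b0 (etrans suma (esym sumb)) cii cC.
have q_le_a i j : q i j <= a i.
  by rewrite -qa (bigD1 j) //= lerDl sumr_ge0.
have q_le_b i j : q i j <= b j.
  by rewrite -qb (bigD1 i) //= lerDl sumr_ge0.
have qz_a i j : a i = 0 -> q i j = 0.
  by move=> ai; apply/eqP; rewrite eq_le q0 andbT -ai.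
have qz_b i j : b j = 0 -> q i j = 0.
  by move=> bj; apply/eqP; rewrite eq_le q0 andbT -bj.
(* If a mass is 0 the quotient is 0 by default; [q] vanishes there too, so [wab] holds in all
   cases. *)
pose w (p : I * I) := q p.1 p.2 / (a p.1 * b p.2).
have w0 p : 0 <= w p by rewrite divr_ge0 // mulr_ge0.
have wb i j : w (i, j) * b j = q i j / a i.
  rewrite /w /=; have [bj|bj] := eqVneq (b j) 0; first by rewrite (qz_b _ _ bj) !mul0r.
  by rewrite invfM mulrA divfK.
have wa i j : w (i, j) * a i = q i j / b j.
  rewrite /w /=; have [ai|ai] := eqVneq (a i) 0; first by rewrite (qz_a _ _ ai) !mul0r.
  by rewrite (mulrC (a i)) invfM mulrA divfK.
have sum_wb i : \sum_j w (i, j) * b j = a i / a i.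
  by under eq_bigr do rewrite wb; rewrite -mulr_suml qa.
have sum_wa j : \sum_i w (i, j) * a i = b j / b j.
  by under eq_bigr do rewrite wa; rewrite -mulr_suml qb.
have wab i j : w (i, j) * (a i * b j) = q i j.
  rewrite mulrCA wb; have [ai|ai] := eqVneq (a i) 0.
    by rewrite (qz_a _ _ ai) mul0r mulr0.
  by rewrite mulrC divfK.
pose K (z : borel H * borel H) : R := \sum_p w p * (phi p.1 z.1 * phi p.2 z.2).
have K0 z : 0 <= K z by apply: sumr_ge0 => p _; rewrite (mulr_ge0 (w0 p)) ?mulr_ge0 ?phi0.
have mK : measurable_fun [set: (borel H * borel H)%type] K.
  apply: measurable_sum => p; apply: measurable_funM; first exact: measurable_cst.
  exact: (measurable_tensor (mphi p.1) (mphi p.2)).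
pose pi0 := density_measure (mu \x nu)%E mK K0.
have ind_q (A : set (borel H)) : measurable A -> quad_growth (\1_A : H -> R).
  move=> mA; apply: (quad_bounded (c := 1)) => // x.
  by rewrite ger0_norm // indicE lern1; case: (_ \in _).
have indE (m : probability (borel H) R) (m2 : finite_second_moment m)
    (A : set (borel H)) :
    measurable A -> (m A = (\sum_i expect m (fun x => phi i x * \1_A x))%:E)%E.
  move=> mA; rewrite -[in LHS](setIT A) -integral_indic // (expectE m2 (ind_q _ mA)).
  congr (_%:E); rewrite -(expect_sum m2) => [|i]; last exact/qphiM/ind_q.
  by congr (expect _ _); apply/funext => x; rewrite -mulr_suml phi1 mul1r.
(* The ratio of a mass to itself is 0 for a piece of mass 0, but the integral of [phi i] over [A],
   being at most this mass, is then 0 as well. *)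
have expect_part (m : probability (borel H) R) (m2 : finite_second_moment m)
    i (A : set (borel H)) :
    measurable A -> expect m (fun x => phi i x * \1_A x) *
      (expect m (phi i) / expect m (phi i)) = expect m (fun x => phi i x * \1_A x).
  move=> mA; have [z|nz] := eqVneq (expect m (phi i)) 0; last by rewrite divff ?mulr1.
  rewrite z mul0r mulr0; apply/esym/eqP; rewrite eq_le expect_ge0 ?andbT => [|x];
    last first.
    by rewrite mulr_ge0.
  rewrite -z; apply: (expect_le m2) => // [|x]; first exact/qphiM/ind_q.
  by rewrite ler_piMr // indicE lern1; case: (_ \in _).
have marg1 A : measurable A -> pi0 (fst @^-1` A) = mu A.
  move=> mA; rewrite (indE _ mu2 _ mA) /pi0 /density_measure integral_mkcond.
  rewrite (eq_integral (fun z : borel H * borel H =>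
      (\sum_p w p * (phi p.1 z.1 * \1_A z.1 * phi p.2 z.2))%:E)); last first.
    move=> z _; rewrite patchE (_ : (z \in fst @^-1` A) = (z.1 \in A)); last first.
      by apply/idP/idP; rewrite !inE.
    rewrite indicE; case: ifP => _ /=.
      by congr (_%:E); apply: eq_bigr => p _; rewrite mulr1.
    by rewrite big1 // => p _; rewrite mulr0 mul0r mulr0.
  rewrite (integral_sum_tensor mu2 nu2 (w := w) (f := fun p x => phi p.1 x * \1_A x)
    (g := fun p => phi p.2)) //; last 2 first.
    by move=> p; exact/qphiM/ind_q.
    by move=> p x; rewrite mulr_ge0.
  congr (_%:E); rewrite -(pair_bigA _ (fun i j =>
    w (i, j) * (expect mu (fun x => phi i x * \1_A x) * b j))) /=.
  apply: eq_bigr => i _; under eq_bigr do rewrite mulrCA.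
  by rewrite -mulr_sumr sum_wb expect_part.
have marg2 A : measurable A -> pi0 (snd @^-1` A) = nu A.
  move=> mA; rewrite (indE _ nu2 _ mA) /pi0 /density_measure integral_mkcond.
  rewrite (eq_integral (fun z : borel H * borel H =>
      (\sum_p w p * (phi p.1 z.1 * (phi p.2 z.2 * \1_A z.2)))%:E)); last first.
    move=> z _; rewrite patchE (_ : (z \in snd @^-1` A) = (z.2 \in A)); last first.
      by apply/idP/idP; rewrite !inE.
    rewrite indicE; case: ifP => _ /=.
      by congr (_%:E); apply: eq_bigr => p _; rewrite mulr1.
    by rewrite big1 // => p _; rewrite !mulr0.
  rewrite (integral_sum_tensor mu2 nu2 (w := w) (f := fun p => phi p.1)
    (g := fun p x => phi p.2 x * \1_A x)) //; last 2 first.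
    by move=> p; exact/qphiM/ind_q.
    by move=> p x; rewrite mulr_ge0.
  congr (_%:E); rewrite -(pair_bigA _ (fun i j =>
    w (i, j) * (a i * expect nu (fun x => phi j x * \1_A x)))) /=.
  rewrite exchange_big; apply: eq_bigr => j _; under eq_bigr do rewrite mulrA mulrC.
  by rewrite -mulr_sumr sum_wa expect_part.
have pi1 : pi0 setT = 1%E by rewrite -(preimage_setT fst) marg1 // probability_setT.
pose P : probability (borel H * borel H)%type R :=
  HB.pack pi0 (Measure_isProbability.Build _ _ _ pi0 pi1).
exists P; first by move=> A mA; split; [exact: marg1|exact: marg2].
(* [S1], [S2] and [S3] are the contributions of [|x - s i|^2], [|s i - s j|^2] and [|y - s j|^2] to
   the bound. *)
pose S1 (z : borel H * borel H) : R :=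
  \sum_p (3 * w p) * (phi p.1 z.1 * `|(z.1 : H) - s p.1| ^+ 2 * phi p.2 z.2).
pose S2 (z : borel H * borel H) : R :=
  \sum_p (3 * (w p * c p.1 p.2)) * (phi p.1 z.1 * phi p.2 z.2).
pose S3 (z : borel H * borel H) : R :=
  \sum_p (3 * w p) * (phi p.1 z.1 * (phi p.2 z.2 * `|(z.2 : H) - s p.2| ^+ 2)).
have w30 p : 0 <= 3 * w p by rewrite mulr_ge0.
have wc0 p : 0 <= 3 * (w p * c p.1 p.2) by rewrite mulr_ge0 // mulr_ge0.
have qphis i : quad_growth (fun x => phi i x * `|x - s i| ^+ 2).
  exact/qphiM/quad_sqr_normB.
have phis0 i x : 0 <= phi i x * `|x - s i| ^+ 2 by rewrite mulr_ge0.
have S10 z : 0 <= S1 z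
  by apply: sumr_ge0 => p _; rewrite (mulr_ge0 (w30 p)) ?mulr_ge0 ?phi0.
have S20 z : 0 <= S2 z
  by apply: sumr_ge0 => p _; rewrite (mulr_ge0 (wc0 p)) ?mulr_ge0 ?phi0.
have S30 z : 0 <= S3 z
  by apply: sumr_ge0 => p _; rewrite (mulr_ge0 (w30 p)) ?mulr_ge0 ?phi0.
have mS1 : measurable_fun [set: (borel H * borel H)%type] S1.
  apply: measurable_sum => p; apply: measurable_funM; first exact: measurable_cst.
  exact: (measurable_tensor (qphis p.1).1 (mphi p.2)).
have mS2 : measurable_fun [set: (borel H * borel H)%type] S2.
  apply: measurable_sum => p; apply: measurable_funM; first exact: measurable_cst.
  exact: (measurable_tensor (mphi p.1) (mphi p.2)).
have mS3 : measurable_fun [set: (borel H * borel H)%type] S3.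
  apply: measurable_sum => p; apply: measurable_funM; first exact: measurable_cst.
  exact: (measurable_tensor (mphi p.1) (qphis p.2).1).
have mdist : measurable_fun [set: (borel H * borel H)%type]
    (fun z => `|(z.1 : H) - z.2| ^+ 2).
  by apply: measurable_funX; exact: measurable_dist.
have I1 : (\int[mu \x nu]_z (S1 z)%:E <=
    (3 * expect mu (fun x => \sum_i phi i x * `|x - s i| ^+ 2))%:E)%E.
  rewrite (integral_sum_tensor mu2 nu2 (w := fun p => 3 * w p)
    (f := fun p x => phi p.1 x * `|x - s p.1| ^+ 2) (g := fun p => phi p.2)) //.
  rewrite lee_fin; under eq_bigr do rewrite -mulrA.
  rewrite -mulr_sumr ler_pM2l // -(pair_bigA _ (fun i j =>
    w (i, j) * (expect mu (fun x => phi i x * `|x - s i| ^+ 2) * b j))) /=.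
  rewrite expect_sum //; apply: ler_sum => i _; under eq_bigr do rewrite mulrCA.
  rewrite -mulr_sumr sum_wb ler_piMr ?expect_ge0 //.
  by have [->|ai] := eqVneq (a i) 0; rewrite ?mul0r ?divff.
have I3 : (\int[mu \x nu]_z (S3 z)%:E <=
    (3 * expect nu (fun x => \sum_i phi i x * `|x - s i| ^+ 2))%:E)%E.
  rewrite (integral_sum_tensor mu2 nu2 (w := fun p => 3 * w p)
    (g := fun p x => phi p.2 x * `|x - s p.2| ^+ 2) (f := fun p => phi p.1)) //.
  rewrite lee_fin; under eq_bigr do rewrite -mulrA.
  rewrite -mulr_sumr ler_pM2l // -(pair_bigA _ (fun i j =>
    w (i, j) * (a i * expect nu (fun x => phi j x * `|x - s j| ^+ 2)))) /=.
  rewrite expect_sum // exchange_big; apply: ler_sum => j _.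
  under eq_bigr do rewrite mulrA mulrC.
  rewrite -mulr_sumr sum_wa ler_piMr ?expect_ge0 //.
  by have [->|bj] := eqVneq (b j) 0; rewrite ?mul0r ?divff.
have I2 : (\int[mu \x nu]_z (S2 z)%:E <= (3 * (C * \sum_i `|a i - b i|))%:E)%E.
  rewrite (integral_sum_tensor mu2 nu2 (w := fun p => 3 * (w p * c p.1 p.2))
    (f := fun p => phi p.1) (g := fun p => phi p.2)) //.
  rewrite lee_fin; under eq_bigr do rewrite -mulrA.
  rewrite -mulr_sumr ler_pM2l // (le_trans _ qC) //.
  rewrite -(pair_bigA _ (fun i j => w (i, j) * c i j * (a i * b j))) /=.
  by apply: ler_sum => i _; apply: ler_sum => j _; rewrite mulrAC wab.
have dens := ge0_integral_density (mu \x nu)%E mK K0 mdist (fun z => sqr_ge0 _).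
apply: (@le_trans _ _ (\int[mu \x nu]_z (S1 z + S3 z + S2 z)%:E)%E); last first.
  under eq_integral do rewrite !EFinD.
  rewrite ge0_integralD //; last 4 first.
  - by move=> z _; rewrite -EFinD lee_fin addr_ge0.
  - by apply: emeasurable_funD; exact/measurable_EFinP.
  - by move=> z _; rewrite lee_fin.
  - exact/measurable_EFinP.
  rewrite ge0_integralD //; last 4 first.
  - by move=> z _; rewrite lee_fin.
  - exact/measurable_EFinP.
  - by move=> z _; rewrite lee_fin.
  - exact/measurable_EFinP.
  by rewrite !EFinD !leeD.
rewrite [leLHS]dens; apply: ge0_le_integral => //.
- by move=> z _; rewrite lee_fin mulr_ge0 // sqr_ge0.
- by apply/measurable_EFinP/measurable_funM.
- by apply/measurable_EFinP; apply: measurable_funD => //; exact: measurable_funD.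
move=> z _; rewrite lee_fin /K mulr_sumr /S1 /S2 /S3 -!big_split /=.
apply: ler_sum => p _.
have tri : `|(z.1 : H) - z.2| ^+ 2 <= 3 * (`|(z.1 : H) - s p.1| ^+ 2 +
    `|(z.2 : H) - s p.2| ^+ 2 + c p.1 p.2).
  have h : `|(z.1 : H) - z.2| <=
      `|(z.1 : H) - s p.1| + `|s p.1 - s p.2| + `|(z.2 : H) - s p.2|.
    rewrite (distrC z.2) (le_trans (ler_distD (s p.2) _ _)) // lerD2r.
    exact: ler_distD.
  have h2 : `|(z.1 : H) - z.2| ^+ 2 <=
      (`|(z.1 : H) - s p.1| + `|s p.1 - s p.2| + `|(z.2 : H) - s p.2|) ^+ 2.
    by rewrite ler_sqr ?nnegrE ?addr_ge0.
  rewrite (le_trans h2) // /c.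
  move: `|z.1 - s p.1| `|s p.1 - s p.2| `|z.2 - s p.2| => x y t.
  have := sqr_ge0 (x - y); have := sqr_ge0 (y - t); have := sqr_ge0 (x - t).
  nra.
have f0 : 0 <= w p * (phi p.1 z.1 * phi p.2 z.2).
  by rewrite (mulr_ge0 (w0 p)) ?mulr_ge0 ?phi0.
rewrite (le_trans (ler_wpM2r f0 tri)) // le_eqVlt; apply/orP; left; apply/eqP.
ring.
Qed.

End MixtureCoupling.

(** * The quantization error and the Wasserstein distance *)

Section Quantization.
Context {R : realType} {H : completeNormedModType R}.
Implicit Types (mu nu : probability (borel H) R) (a : H * H).

Definition dist2 a (x : H) : R := Num.min (`|x - a.1| ^+ 2) (`|x - a.2| ^+ 2).

Lemma dist2_ge0 a x : 0 <= dist2 a x.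
Proof. by rewrite le_min !sqr_ge0. Qed.

Lemma quad_dist2 a : quad_growth (dist2 a).
Proof.
apply: (quad_le (c := 1) _ (quad_sqr_normB a.1)) => [|x].
  apply: measurable_minr; apply: measurable_funX; exact: measurable_normB.
by rewrite mul1r ger0_norm ?dist2_ge0 // ger0_norm ?sqr_ge0 // ge_min lexx.
Qed.

Lemma e22E mu a : e22 mu a = Num.sqrt (expect mu (dist2 a)).
Proof. by []. Qed.

Lemma sqr_e22 mu a : e22 mu a ^+ 2 = expect mu (dist2 a).
Proof. by rewrite sqr_sqrtr // expect_ge0 // => x; exact: dist2_ge0. Qed.

(** Change of variables: the image of [pi] under [p] agrees with [mu] on measurable sets, which
    determines the integral. *)
Lemma integral_marginal d (T : measurableType d) (pi : probability T R) mu
    (p : T -> borel H) (f : H -> R) : measurable_fun setT p ->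
  (forall A, measurable A -> pi (p @^-1` A) = mu A) ->
  measurable_fun [set: borel H] f -> (forall x, 0 <= f x) ->
  (\int[pi]_z (f (p z))%:E = \int[mu]_x (f x)%:E)%E.
Proof.
move=> mp pimu mf f0.
pose X : {mfun T >-> borel H} := HB.pack p (isMeasurableFun.Build _ _ _ _ _ mp).
transitivity (\int[distribution pi X]_x (f x)%:E)%E; last first.
  by apply: eq_measure_integral => A mA _; exact: pimu.
rewrite (ge0_integral_distribution X (f := fun x => (f x)%:E)) //.
  exact/measurable_EFinP.
Qed.

(** The infimum over [t] of the right-hand side is [(sqrt G + d)^2], approached near
    [t = d / sqrt G]. *)
Lemma sqrt_le_of_quadratic (F G d : R) : 0 <= G -> 0 <= d ->
  (forall t, 0 < t -> F <= (1 + t) * G + (1 + t^-1) * d ^+ 2) ->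
  Num.sqrt F <= Num.sqrt G + d.
Proof.
move=> G0 d0 Ft; apply/ler_addgt0Pr => e e0.
(* The shifts by [e / 2] make [t = c / g] legitimate even if [G] or [d] is 0. *)
pose g := Num.sqrt G + e / 2; pose c := d + e / 2.
have s0 := sqrtr_ge0 G.
have g0 : 0 < g by rewrite /g; lra.
have c0 : 0 < c by rewrite /c; lra.
have -> : Num.sqrt G + d + e = g + c by rewrite /g /c; field.
have Gg : G <= g ^+ 2.
  by rewrite -{1}(sqr_sqrtr G0) ler_sqr ?nnegrE ?(ltW g0) // lerDl; lra.
have dc : d ^+ 2 <= c ^+ 2 by rewrite ler_sqr ?nnegrE ?(ltW c0) // lerDl; lra.
apply: (@le_trans _ _ (Num.sqrt ((g + c) ^+ 2))); last first.
  by rewrite sqrtr_sqr ger0_norm // addr_ge0 ?ltW.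
apply: ler_wsqrtr.
have cg : 0 < c / g by rewrite divr_gt0.
apply: (le_trans (Ft _ cg)).
apply: (@le_trans _ _ ((1 + c / g) * g ^+ 2 + (1 + (c / g)^-1) * c ^+ 2)).
  rewrite lerD // ler_wpM2l // addr_ge0 // ?invr_ge0 ltW //.
rewrite le_eqVlt; apply/orP; left; apply/eqP.
by field; rewrite !gt_eqF.
Qed.

(** Young's inequality applied to the component of [a] nearest to [y], which is an admissible choice
    for [x]. *)
Lemma dist2_young a (x y : H) t : 0 < t ->
  dist2 a x <= (1 + t) * dist2 a y + (1 + t^-1) * `|x - y| ^+ 2.
Proof.
move=> t0.
have young c : `|x - c| ^+ 2 <= (1 + t) * `|y - c| ^+ 2 + (1 + t^-1) * `|x - y| ^+ 2.
  apply: (@le_trans _ _ ((`|x - y| + `|y - c|) ^+ 2)).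
    by rewrite ler_sqr ?nnegrE ?addr_ge0 // ler_distD.
  move: `|x - y| `|y - c| => u v; rewrite -subr_ge0.
  have -> : (1 + t) * v ^+ 2 + (1 + t^-1) * u ^+ 2 - (u + v) ^+ 2 =
    t^-1 * (u - t * v) ^+ 2 by field; rewrite gt_eqF.
  by rewrite mulr_ge0 ?sqr_ge0 // invr_ge0 ltW.
rewrite [dist2 a y]/dist2; case: (leP (`|y - a.1| ^+ 2) (`|y - a.2| ^+ 2)) => _.
  by rewrite (le_trans _ (young _)) // ge_min lexx.
by rewrite (le_trans _ (young _)) // ge_min lexx orbT.
Qed.

(* Minkowski's inequality in the equivalent form of a family of quadratic
   bounds, which only needs linearity of the integral. *)
Lemma e22_lipschitz mu nu (pi : probability (borel H * borel H)%type R) (d : R) a :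
  separable_space H -> finite_second_moment mu -> finite_second_moment nu ->
  coupling mu nu pi -> 0 <= d ->
  (\int[pi]_z (`|(z.1 : H) - z.2| ^+ 2)%:E <= (d ^+ 2)%:E)%E ->
  `|e22 mu a - e22 nu a| <= d.
Proof.
move=> sepH mu2 nu2 cpl d0 pid.
have q := quad_dist2 a.
have mdist : measurable_fun [set: (borel H * borel H)%type]
    (fun z => `|(z.1 : H) - z.2| ^+ 2).
  by apply: measurable_funX; exact: measurable_dist.
have E1 : (\int[pi]_z (dist2 a z.1)%:E = (expect mu (dist2 a))%:E)%E.
  rewrite -(expectE mu2 q); apply: (integral_marginal (p := fst)) => //.
  - by move=> A /cpl[].
  - exact: q.1.
  - exact: dist2_ge0.
have E2 : (\int[pi]_z (dist2 a z.2)%:E = (expect nu (dist2 a))%:E)%E.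
  rewrite -(expectE nu2 q); apply: (integral_marginal (p := snd)) => //.
  - by move=> A /cpl[].
  - exact: q.1.
  - exact: dist2_ge0.
have m1 : measurable_fun [set: (borel H * borel H)%type] (fun z => dist2 a z.1).
  exact: (measurableT_comp q.1 measurable_fst).
have m2 : measurable_fun [set: (borel H * borel H)%type] (fun z => dist2 a z.2).
  exact: (measurableT_comp q.1 measurable_snd).
(* Stated for general [f] and [g] because it is used in both directions. *)
have bound (f g : borel H * borel H -> R) (F G t : R) :
    measurable_fun setT f -> measurable_fun setT g ->
    (forall z, 0 <= f z) -> (forall z, 0 <= g z) ->
    (\int[pi]_z (f z)%:E = F%:E)%E -> (\int[pi]_z (g z)%:E = G%:E)%E -> 0 < t ->
    (forall z, f z <= (1 + t) * g z + (1 + t^-1) * `|(z.1 : H) - z.2| ^+ 2) ->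
    F <= (1 + t) * G + (1 + t^-1) * d ^+ 2.
  move=> mf mg f0 g0 fF gG t0 fg.
  have t1 : 0 <= 1 + t by rewrite addr_ge0 // ltW.
  have t2 : 0 <= 1 + t^-1 by rewrite addr_ge0 // invr_ge0 ltW.
  rewrite -lee_fin -fF EFinD (EFinM (1 + t)) (EFinM (1 + t^-1)) -gG.
  apply: (@le_trans _ _ (\int[pi]_z ((1 + t)%:E * (g z)%:E +
      (1 + t^-1)%:E * (`|(z.1 : H) - z.2| ^+ 2)%:E))%E).
    apply: ge0_le_integral => //.
    - by move=> z _; rewrite lee_fin.
    - exact/measurable_EFinP.
    - by apply/measurable_EFinP; apply: measurable_funD; apply: measurable_funM.
    - by move=> z _; rewrite lee_fin.
  rewrite ge0_integralD //; last 4 first.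
  - by move=> z _; rewrite lee_fin mulr_ge0.
  - by apply/measurable_EFinP; apply: measurable_funM.
  - by move=> z _; rewrite lee_fin mulr_ge0 // sqr_ge0.
  - by apply/measurable_EFinP; apply: measurable_funM.
  rewrite !ge0_integralZl_EFin //; last 3 first.
  - exact/measurable_EFinP.
  - by move=> z _; rewrite lee_fin.
  - exact/measurable_EFinP.
  by rewrite leeD // lee_wpmul2l // lee_fin.
rewrite !e22E ler_distl lerBlDr; apply/andP; split.
  apply: sqrt_le_of_quadratic => // [|t t0].
    by rewrite expect_ge0 // => x; exact: dist2_ge0.
  apply: bound E2 E1 _ _ => // z; try exact: dist2_ge0.
  by rewrite (distrC z.1) dist2_young.
apply: sqrt_le_of_quadratic => // [|t t0].
  by rewrite expect_ge0 // => x; exact: dist2_ge0.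
by apply: bound E1 E2 _ _ => // z; [exact: dist2_ge0|exact: dist2_ge0|exact: dist2_young].
Qed.

End Quantization.

(** * Bounds on the Wasserstein distance and uniform convergence *)

Section Wasserstein.
Context {R : realType} {H : completeNormedModType R}.
Implicit Types (mu nu : probability (borel H) R).

Lemma W2_ge0 mu nu : (0 <= W2 mu nu)%E.
Proof. exact: sqrte_ge0. Qed.

Lemma W2_le mu nu (pi : probability (borel H * borel H)%type R) (c : R) :
  coupling mu nu pi -> 0 <= c ->
  (\int[pi]_z (`|(z.1 : H) - z.2| ^+ 2)%:E <= c%:E)%E ->
  (W2 mu nu <= (Num.sqrt c)%:E)%E.
Proof.
move=> cpl c0 pic.
have -> : (Num.sqrt c)%:E = sqrte c%:E by [].
rewrite /W2 lee_sqrt ?lee_fin //; apply: le_trans pic.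
by apply: ereal_inf_lbound; exists pi.
Qed.

Lemma W2_lt mu nu (e : R) : 0 <= e -> (W2 mu nu < e%:E)%E ->
  exists2 pi : probability (borel H * borel H)%type R, coupling mu nu pi &
    (\int[pi]_z (`|(z.1 : H) - z.2| ^+ 2)%:E <= (e ^+ 2)%:E)%E.
Proof.
move=> e0 We.
have : (ereal_inf [set (\int[pi]_z (`|(z.1 : H) - z.2| ^+ 2)%:E)%E
   | pi in coupling mu nu] < (e ^+ 2)%:E)%E.
  rewrite ltNge; apply: contraTN We => We; rewrite -leNgt.
  have -> : e%:E = sqrte (e ^+ 2)%:E by rewrite /= sqrtr_sqr ger0_norm.
  by rewrite /W2 lee_sqrt // (le_trans _ We) // lee_fin sqr_ge0.
by move=> /ereal_inf_lt[_ [pi cpl <-] /ltW pie]; exists pi.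
Qed.

(** [W2] is extended-real: its eventual finiteness has to be derived along with the convergence of
    its real values. *)
Lemma cvg_W2P (mu : nat -> probability (borel H) R) nu :
  (forall e, 0 < e -> \forall n \near \oo, (W2 (mu n) nu <= e%:E)%E) ->
  (W2 (mu n) nu @[n --> \oo] --> 0%E).
Proof.
move=> We; apply/fine_cvgP; split.
  have := We _ ltr01; apply: filter_app; near=> n => Wn.
  by rewrite ge0_fin_numE ?W2_ge0 // (le_lt_trans Wn) // ltry.
apply/cvgrPdist_le => e e0; have := We _ e0; apply: filter_app; near=> n => Wn.
rewrite sub0r normrN ger0_norm ?fine_ge0 ?W2_ge0 //.
by rewrite -lee_fin fineK // ge0_fin_numE ?W2_ge0 // (le_lt_trans Wn) // ltry.
Unshelve. all: by end_near. Qed.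

(** A single coupling of cost at most [e^2] controls all pairs [a] at once. *)
Lemma W2_cvg_e22 (mu : nat -> probability (borel H) R) nu :
  separable_space H -> (forall n, (0 < n)%N -> finite_second_moment (mu n)) ->
  finite_second_moment nu -> W2 (mu n) nu @[n --> \oo] --> 0%E ->
  forall e, 0 < e -> \forall n \near \oo, forall a, `|e22 (mu n) a - e22 nu a| <= e.
Proof.
move=> sepH mu2 nu2 /fine_cvgP[Wfin /cvgrPdist_lt W0] e e0.
have := W0 _ e0; apply: filter_app; move: Wfin; apply: filter_app.
near=> n => Wfin; rewrite sub0r normrN => We a.
have [|pi cpl pie] := @W2_lt (mu n) nu e (ltW e0).
  by rewrite -(fineK Wfin) lte_fin (le_lt_trans (ler_norm _)).
apply: (e22_lipschitz a sepH _ nu2 cpl (ltW e0) pie).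
by apply: mu2; near: n; exists 1%N.
Unshelve. all: by end_near. Qed.

End Wasserstein.

(** * From pointwise convergence to Wasserstein convergence *)

Section PointwiseToW2.
Context {R : realType} {H : completeNormedModType R}.
Variable dot : {dot H for idfun}.
Hypothesis norm_dot : forall x : H, `|x| = Num.sqrt (dot x x).
Hypothesis sepH : separable_space H.
Variables (mu : nat -> probability (borel H) R) (nu : probability (borel H) R).
Hypothesis mu2 : forall n, finite_second_moment (mu n).
Hypothesis nu2 : finite_second_moment nu.
Hypothesis cvg_e22 : forall a : H * H, e22 (mu n) a @[n --> \oo] --> e22 nu a.

Let cvgE f := cvg_expect mu nu f.

Lemma cvg_expect_dist2 a : cvgE (dist2 a).
Proof.
split; first exact: quad_dist2.
rewrite -sqr_e22; under eq_fun do rewrite -sqr_e22.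
by rewrite expr2; under eq_fun do rewrite expr2; exact: cvgM.
Qed.

Lemma cvg_expect_sqr_normB a : cvgE (fun x => `|x - a| ^+ 2).
Proof.
have := cvg_expect_dist2 (a, a).
by congr cvgE; apply/funext => x; rewrite /dist2 /= minxx.
Qed.

Lemma cvg_expect_sqr_norm : cvgE (fun x => `|x| ^+ 2).
Proof.
have := cvg_expect_sqr_normB 0.
by congr cvgE; apply/funext => x; rewrite subr0.
Qed.

(* [|x - a|^2 - min (|x - a|^2, |x - b|^2)] is the positive part of the affine
   function [2 (x | b - a) + |a|^2 - |b|^2], and [a], [b] on the line spanned by
   [u] can be chosen to make the latter [(x | u) + c]. *)
Lemma cvg_expect_ramp u c : cvgE (fun x => Num.max 0 (dot x u + c)).
Proof.
have [->|u0] := eqVneq u 0.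
  have := cvg_expect_cst mu nu (Num.max 0 c).
  by congr cvgE; apply/funext => x; rewrite dot0r add0r.
(* As [b - a = u / 2], the linear part is [(x | u)]; the constant [|a|^2 - |b|^2] equals
   [- t * |u|^2], which must be [c]. *)
pose t := - c / `|u| ^+ 2.
have un0 : `|u| ^+ 2 != 0 by rewrite sqrf_eq0 normr_eq0.
pose a := (t - 4^-1) *: u; pose b := (t + 4^-1) *: u.
have ab x : `|x - a| ^+ 2 - `|x - b| ^+ 2 = dot x u + c.
  rewrite !(sqr_normB norm_dot) !(sqr_norm norm_dot) /a /b !dotZr !dotZl.
  rewrite -(sqr_norm norm_dot u).
  have -> : c = - t * `|u| ^+ 2 by rewrite /t mulNr divfK // opprK.
  by field.
have := cvg_expectB mu2 nu2 (cvg_expect_sqr_normB a) (cvg_expect_dist2 (a, b)).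
congr cvgE; apply/funext => x; rewrite -ab /dist2 /=.
by case: (leP (`|x - a| ^+ 2) (`|x - b| ^+ 2)) => h;
  [rewrite subrr max_l // subr_le0|rewrite max_r // subr_ge0 ltW].
Qed.

Lemma cvg_expect_trig f : trig dot f -> cvgE f.
Proof.
by apply: cvg_trig => //; [exact: cvg_expect_sqr_norm|exact: cvg_expect_ramp].
Qed.

(** In the expansion of the squares the weights of [|x|^2] sum to 1, so only the plain second
    moment, the products [phi i x * (x | s i)] and the [phi i] themselves have to converge. *)
Lemma cvg_expect_mixture W : mixture dot W -> cvgE W.
Proof.
move=> /(mixture_family)[n [phi [s [tphi _ phi1 WE]]]].
have : cvgE (fun x => `|x| ^+ 2 +
    \sum_i (-2 * (phi i x * dot x (s i)) + `|s i| ^+ 2 * phi i x)).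
  apply: cvg_expectD => //; first exact: cvg_expect_sqr_norm.
  apply: cvg_expect_sum => // i; apply: cvg_expectD => //; apply: cvg_expectZ => //.
    by apply: cvg_trig_dot => //; [exact: cvg_expect_sqr_norm|exact: cvg_expect_ramp].
  exact: cvg_expect_trig.
congr cvgE; apply/funext => x; rewrite WE.
have -> : `|x| ^+ 2 = \sum_i phi i x * `|x| ^+ 2 by rewrite -mulr_suml phi1 mul1r.
rewrite -big_split /=.
apply: eq_bigr => i _; rewrite (sqr_normB norm_dot); ring.
Qed.

Lemma pointwise_cvg_W2 : W2 (mu n) nu @[n --> \oo] --> 0%E.
Proof.
apply: cvg_W2P => e e0.
(* The coupling bound tends to 6 times the integral of [W] under [nu], at most [6 d < e^2]. *)
pose d := e ^+ 2 / 8.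
have e20 : 0 < e ^+ 2 by rewrite exprn_gt0.
have d0 : 0 < d by rewrite divr_gt0.
have [W mW Wd] := small_mixture norm_dot nu2 sepH d0.
have [qW cW] := cvg_expect_mixture mW.
have [k [phi [s [tphi phi0 phi1 WE]]]] := mixture_family mW.
have WEf : (fun x => \sum_i phi i x * `|x - s i| ^+ 2) = W by apply/funext => x.
pose C := \sum_i \sum_j `|s i - s j| ^+ 2.
pose bnd n := 3 * expect (mu n) W + 3 * expect nu W +
  3 * (C * \sum_i `|expect (mu n) (phi i) - expect nu (phi i)|).
have cb : bnd n @[n --> \oo] --> 3 * expect nu W + 3 * expect nu W + 3 * (C * 0).
  apply: cvgD; first by apply: cvgD; [exact: cvgMr|exact: cvg_cst].
  apply: cvgMr; apply: cvgMr.
  rewrite [X in _ --> X](_ : 0 = \sum_(i < k) (0 : R)); last by rewrite big1.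
  apply: (cvg_big add_continuous) => i _.
  rewrite -(normr0 R) -(subrr (expect nu (phi i))).
  apply: cvg_norm; apply: cvgB; last exact: cvg_cst.
  by have [] := cvg_expect_trig (tphi i).
have : \forall n \near \oo, bnd n <= e ^+ 2.
  apply: (cvgr_le _ cb); rewrite !mulr0 addr0.
  by move: Wd; rewrite /d; lra.
apply: filter_app; near=> n => bn.
have [pi cpl pib] := mixture_coupling (mu2 n) nu2 sepH s
  (fun i => trig_measurable norm_dot (tphi i)) phi0 phi1.
rewrite WEf in pib.
have -> : e = Num.sqrt (e ^+ 2) by rewrite sqrtr_sqr gtr0_norm.
apply: (W2_le cpl (ltW e20)); apply: (le_trans pib).
by rewrite lee_fin.
Unshelve. all: by end_near. Qed.

End PointwiseToW2.

Unset Implicit Arguments.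

Theorem theorem3p1 (R : realType) (H : completeNormedModType R)
    (dot : {dot H for idfun})
    (norm_dot : forall x : H, `|x| = Num.sqrt (dot x x))
    (sepH : separable_space H)
    (mu : nat -> probability (borel H) R) (mu_oo : probability (borel H) R)
    (mu_P2 : forall n, (0 < n)%N -> finite_second_moment (mu n))
    (mu_oo_P2 : finite_second_moment mu_oo) :
  [<-> W2 (mu n) mu_oo @[n --> \oo] --> 0%E;
       {uniform, e22 (mu n) @[n --> \oo] --> e22 mu_oo};
       forall ab : H * H, e22 (mu n) ab @[n --> \oo] --> e22 mu_oo ab].
Proof.
tfae.
- move=> W0 P /uniform_nbhs[E [+ EP]].
  rewrite -entourage_ballE => -[e /= e0 eE].
  (* Halving turns the large inequality of [W2_cvg_e22] into the strict one of the ball. *)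
  have e20 : 0 < e / 2 by rewrite divr_gt0.
  have := W2_cvg_e22 sepH mu_P2 mu_oo_P2 W0 e20.
  apply: filter_app; near=> n => H1; apply: EP => ab _; apply: eE.
  rewrite /= /ball /= distrC (le_lt_trans (H1 ab)) //; lra.
- move=> H2 ab.
  have : {uniform [set ab], e22 (mu n) @[n --> \oo] --> e22 mu_oo}.
    exact: uniform_subset_cvg H2.
  by rewrite uniform_set1.
(* The shift drops the index 0, where [mu] is not assumed to have a finite second moment. *)
- move=> H3; rewrite -(cvg_shiftS (fun n => W2 (mu n) mu_oo)).
  apply: (pointwise_cvg_W2 norm_dot sepH) => // [n|a]; first exact: mu_P2.
  by rewrite (cvg_shiftS (fun n => e22 (mu n) a)).
Unshelve. all: by end_near. Qed.
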